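(* Let $p$ be an odd prime, let $G$, with its closed normal subgroups $Z\le H$, be the pro-$p$ group defined in the context, and let $\mathcal{S}$ be an arbitrary filtration series of $G$. Then the normal Hausdorff spectrum of $G$ has the form \[ \mathrm{hspec}^{\mathcal{S}}_{\trianglelefteq}(G)=[0,\xi]\cup\{\eta\}\cup\{1\}, \] where $\xi=\mathrm{hdim}^{\mathcal{S}}_G(Z)$ and $\eta=\mathrm{hdim}^{\mathcal{S}}_G(H)$.
   Context: Hausdorff dimension. A filtration series $\mathcal{S}$ of a countably based infinite pro-$p$ group $\Gamma$ is a descending chain $\Gamma=\Gamma_0\supseteq\Gamma_1\supseteq\cdots$ of open normal subgroups with $\bigcap_i\Gamma_i=1$. For a closed subgroup $K\le\Gamma$, $\mathrm{hdim}^{\mathcal{S}}_\Gamma(K)=\liminf_{i\to\infty}\frac{\log_p|K\Gamma_i:\Gamma_i|}{\log_p|\Gamma:\Gamma_i|}$, and $\mathrm{hspec}^{\mathcal{S}}_{\trianglelefteq}(\Gamma)=\{\mathrm{hdim}^{\mathcal{S}}_\Gamma(K)\mid K\text{ a closed normal subgroup of }\Gamma\}$. The group. Let $W=C_p\mathrel{\hat{\wr}}\mathbb{Z}_p=\varprojlim_k C_p\wr C_{p^k}=\langle x,y\rangle=\langle x\rangle\ltimes B$, with top group $\langle x\rangle\cong\mathbb{Z}_p$ and base group $B\cong C_p^{\aleph_0}$, the closed subgroup generated by all $y^{x^i}$, $i\in\mathbb{Z}$ (concretely $W\cong\langle 1+t\rangle\ltimes\mathbb{F}_p[\![t]\!]$,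 where $x$ corresponds to $1+t$ acting by multiplication, $y$ to $1\in\mathbb{F}_p[\![t]\!]$ and $B$ to $\mathbb{F}_p[\![t]\!]$). Let $F=\langle x,y\rangle$ be the free pro-$p$ group on $x,y$, let $R$ be the kernel of the epimorphism $F\to W$ sending $x,y$ to the generators of the same name, and let $N=[R,F]R^p$ (closed subgroup). Put $G=F/N$, $Z=R/N$, and let $H$ be the preimage of $B$ under the projection $G\to G/Z\cong W$, i.e. the closed subgroup generated by $Z$ and all $y^{x^i}$, $i\in\mathbb{Z}$. *)

(* Defs.v *)
From HB Require Import structures.
From mathcomp Require Import all_boot all_order all_algebra.
From mathcomp Require Import finmap.
From mathcomp Require Import all_classical all_reals all_analysis.

Set Implicit Arguments.
Unset Strict Implicit.
Unset Printing Implicit Defensive.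

Import Order.TTheory GRing.Theory Num.Theory.
Import numFieldNormedType.Exports.

Local Open Scope classical_set_scope.
Local Open Scope group_scope.

HB.mixin Record isTopologicalGroup T & Topological T & Group T := {
  mulg_continuous : continuous (fun u : T * T => u.1 * u.2) ;
  invg_continuous : continuous (fun u : T => u^-1)
}.

#[short(type="topGroupType")]
HB.structure Definition TopologicalGroup :=
  {T of Topological T & Group T & isTopologicalGroup T}.

Section Subgroups.
Variable T : groupType.
Implicit Types K L A : set T.

Definition subgroup K :=
  [/\ K 1, forall u v, K u -> K v -> K (u * v) & forall u, K u -> K u^-1].

Definition normal_subgroup K :=
  subgroup K /\ forall u v, K u -> K (u ^ v).

Definition mul_set K L := [set u * v | u in K & v in L].

Definition lcoset u L := [set u * v | v in L].

(* The index |K : L|; it takes the junk value 0 when it is infinite. *)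
Definition gindex K L := #|` fset_set [set lcoset u L | u in K]|.

Definition expgz (u : T) (i : int) : T :=
  match i with Posz n => u ^+ n | Negz n => u ^- n.+1 end.

Record normalSubgroup := NormalSubgroup {
  nsub_set :> set T;
  nsubP : normal_subgroup nsub_set
}.

End Subgroups.

Definition closed_generated (T : topGroupType) (A : set T) : set T :=
  \bigcap_(K in [set K | [/\ subgroup K, closed K & A `<=` K]]) K.

Definition pro_p (p : nat) (T : topGroupType) :=
  [/\ compact [set: T], hausdorff_space T, totally_disconnected [set: T] &
      forall U : set T, open U -> normal_subgroup U ->
        exists k, gindex setT U = (p ^ k)%N].

Definition free_pro_p (p : nat) (F : topGroupType) (x y : F) :=
  pro_p p F /\
  forall (T : topGroupType) (a b : T), pro_p p T ->
    exists! f : F -> T,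
      [/\ {morph f : u v / u * v}, continuous f, f x = a & f y = b].

Definition filtration_series (T : topGroupType) (S : nat -> set T) :=
  [/\ S 0%N = setT,
      forall i, S i.+1 `<=` S i,
      forall i, open (S i) /\ normal_subgroup (S i) &
      \bigcap_i S i = [set 1]].

Section HausdorffDimension.
Variables (R : realType) (p : nat) (T : topGroupType) (S : nat -> set T).

Definition logp (n : nat) : R := (ln n%:R / ln p%:R)%R.

Definition hdim (K : set T) : R :=
  limn_inf (fun i =>
    logp (gindex (mul_set K (S i)) (S i)) / logp (gindex setT (S i)))%R.

Definition hspec_normal : set R :=
  [set hdim K | K in [set K | closed K /\ normal_subgroup K]].

End HausdorffDimension.

Section Quotient.
Variables (T : topGroupType) (N : normalSubgroup T).

Definition coset_rel (u v : T) : bool := `[< nsub_set N (u^-1 * v) >].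

Lemma coset_rel_refl : reflexive coset_rel.
Proof. by move=> u; apply/asboolP; rewrite mulVg; case: (nsubP N) => -[]. Qed.

Lemma coset_rel_sym : symmetric coset_rel.
Proof.
case: (nsubP N) => -[_ _ NV] _.
have sub u v : nsub_set N (u^-1 * v) -> nsub_set N (v^-1 * u).
  by move=> /NV; rewrite invgM invgK.
by move=> u v; apply/asboolP/asboolP; exact: sub.
Qed.

Lemma coset_rel_trans : transitive coset_rel.
Proof.
move=> v u w /asboolP Nuv /asboolP Nvw; apply/asboolP.
case: (nsubP N) => -[_ NM _] _.
by have := NM _ _ Nuv Nvw; rewrite -mulgA mulVKg.
Qed.

Canonical coset_equiv :=
  EquivRel coset_rel coset_rel_refl coset_rel_sym coset_rel_trans.

Definition quo : Type := quotient_topology {eq_quot coset_equiv}%qT.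

HB.instance Definition _ := Topological.on quo.
HB.instance Definition _ := Quotient.on quo.

Local Open Scope quotient_scope.

Lemma quo_eqP (u v : T) : \pi_quo u = \pi_quo v <-> nsub_set N (u^-1 * v).
Proof.
split=> [/eqquotP/asboolP //|Nuv].
by apply/eqquotP/asboolP.
Qed.

Definition quo_mul (a b : quo) : quo := \pi_quo (repr a * repr b).
Definition quo_inv (a : quo) : quo := \pi_quo (repr a)^-1.

Lemma quo_mulE u v : quo_mul (\pi u) (\pi v) = \pi_quo (u * v).
Proof.
case: (nsubP N) => -[_ NM NV] NJ.
have /quo_eqP Nu : \pi_quo (repr (\pi_quo u)) = \pi_quo u by rewrite reprK.
have /quo_eqP Nv : \pi_quo (repr (\pi_quo v)) = \pi_quo v by rewrite reprK.
apply/quo_eqP; have := NM _ _ (NJ _ (repr (\pi_quo v)) Nu) Nv.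
by rewrite conjgE invgM !mulgA !mulgK.
Qed.

Lemma quo_invE u : quo_inv (\pi u) = \pi_quo u^-1.
Proof.
case: (nsubP N) => -[_ NM NV] NJ.
have /quo_eqP Nu : \pi_quo (repr (\pi_quo u)) = \pi_quo u by rewrite reprK.
apply/quo_eqP; have := NV _ (NJ _ (repr (\pi_quo u))^-1 Nu).
by rewrite conjgE invgK -mulgA mulVKg invgM !invgK.
Qed.

Lemma quo_mulA : associative quo_mul.
Proof.
move=> a b c; rewrite -(reprK a) -(reprK b) -(reprK c).
by rewrite !quo_mulE mulgA.
Qed.

Lemma quo_mul1 : left_id (\pi_quo 1) quo_mul.
Proof. by move=> a; rewrite -(reprK a) quo_mulE mul1g. Qed.

Lemma quo_mulr1 : right_id (\pi_quo 1) quo_mul.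
Proof. by move=> a; rewrite -(reprK a) quo_mulE mulg1. Qed.

Lemma quo_mulV : left_inverse (\pi_quo 1) quo_inv quo_mul.
Proof. by move=> a; rewrite -(reprK a) quo_invE quo_mulE mulVg. Qed.

Lemma quo_mulrV : right_inverse (\pi_quo 1) quo_inv quo_mul.
Proof. by move=> a; rewrite -(reprK a) quo_invE quo_mulE mulgV. Qed.

HB.instance Definition _ :=
  isGroup.Build quo quo_mulA quo_mul1 quo_mulr1 quo_mulV quo_mulrV.

Lemma piM u v : \pi_quo (u * v) = \pi_quo u * \pi_quo v.
Proof. by rewrite -quo_mulE. Qed.

Lemma piV u : \pi_quo u^-1 = (\pi_quo u)^-1.
Proof. by rewrite -quo_invE. Qed.

Lemma pi_quo_continuous : continuous (\pi_quo : T -> quo).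
Proof. exact: pi_continuous. Qed.

Lemma mulgl_continuous (u : T) : continuous ( *%g u : T -> T).
Proof.
move=> v; apply: (@continuous_comp _ _ _ (fun w => (u, w))
  (fun w : T * T => w.1 * w.2)); last exact: mulg_continuous.
by apply: cvg_pair; [exact: cvg_cst|exact: cvg_id].
Qed.

Lemma mulgr_continuous (u : T) : continuous (fun v : T => v * u).
Proof.
move=> v; apply: (@continuous_comp _ _ _ (fun w => (w, u))
  (fun w : T * T => w.1 * w.2)); last exact: mulg_continuous.
by apply: cvg_pair; [exact: cvg_id|exact: cvg_cst].
Qed.

Lemma pi_quo_open (A : set T) : open A -> open (\pi_quo @` A : set quo).
Proof.
move=> oA.
have E : \pi_quo @^-1` (\pi_quo @` A : set quo) =
         \bigcup_(n in nsub_set N) ((fun v : T => v * n) @^-1` A).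
  apply/seteqP; split=> v.
    move=> [u Au /quo_eqP Nuv]; exists (v^-1 * u).
      by case: (nsubP N) => -[_ _ NV] _; have := NV _ Nuv; rewrite invgM invgK.
    by rewrite /= mulVKg.
  move=> [n Nn Avn]; exists (v * n) => //.
  apply/quo_eqP; rewrite invgM mulgVK.
  by case: (nsubP N) => -[_ _ NV] _; exact: NV.
have : open (\pi_quo @^-1` (\pi_quo @` A : set quo)); last by [].
rewrite E; apply: bigcup_open => n _.
by move/continuousP: (@mulgr_continuous n); apply.
Qed.

Lemma quo_mulg_continuous : continuous (fun a : quo * quo => a.1 * a.2).
Proof.
move=> [a b] /= A; rewrite nbhsE => -[B [oB Bab] BA].
have := @mulg_continuous T (repr a, repr b) (\pi_quo @^-1` B) => /=.
case.
  apply: open_nbhs_nbhs; split; first exact: oB.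
  by rewrite /= piM !reprK.
move=> [U V] /= [nU nV] UV.
exists (\pi_quo @` U°, \pi_quo @` V°) => /=.
  split.
    apply: open_nbhs_nbhs; split; first exact/pi_quo_open/open_interior.
    by exists (repr a); rewrite ?reprK.
  apply: open_nbhs_nbhs; split; first exact/pi_quo_open/open_interior.
  by exists (repr b); rewrite ?reprK.
move=> [c d] /= [[u Uu <-] [v Vv <-]].
rewrite -piM; apply: BA; apply: (UV (u, v)) => /=.
by split; exact: interior_subset.
Qed.

Lemma quo_invg_continuous : continuous (fun a : quo => a^-1).
Proof.
apply/continuousP => A oA.
have /continuousP/(_ _ oA) := pi_quo_continuous.
move/continuousP: (@invg_continuous T) => /[apply] oB.
have E : \pi_quo @^-1` ((fun a : quo => a^-1) @^-1` A) =
         (fun u : T => u^-1) @^-1` (\pi_quo @^-1` A).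
  by apply/seteqP; split=> u /=; rewrite piV.
have : open (\pi_quo @^-1` ((fun a : quo => a^-1) @^-1` A)); last by [].
by rewrite E.
Qed.

HB.instance Definition _ :=
  isTopologicalGroup.Build quo quo_mulg_continuous quo_invg_continuous.

End Quotient.

Section Wreath.
Local Open Scope ring_scope.
Variables (A : zmodType) (C : finZmodType).

(* The regular wreath product of the additively written groups A and C.  The
   pair (c, f) stands for the product of c in the top group and f in the base
   group A^C; the top group acts by (f ^ c) d = f (d - c). *)
Definition wreath : Type := (C * {ffun C -> A})%type.

HB.instance Definition _ := Choice.on wreath.

Definition wr_one : wreath := (0, 0).
Definition wr_mul (u v : wreath) : wreath :=
  (u.1 + v.1, [ffun d => u.2 (d - v.1) + v.2 d]).
Definition wr_inv (u : wreath) : wreath :=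
  (- u.1, [ffun d => - u.2 (d + u.1)]).

Lemma wr_mulA : associative wr_mul.
Proof.
move=> u v w; congr pair; first exact: addrA.
by apply/ffunP => d; rewrite !ffunE /= addrA [(v.1 + _)%R]addrC opprD addrA.
Qed.

Lemma wr_mul1 : left_id wr_one wr_mul.
Proof.
case=> c f; congr pair; first exact: add0r.
by apply/ffunP => d; rewrite !ffunE /= add0r.
Qed.

Lemma wr_mulr1 : right_id wr_one wr_mul.
Proof.
case=> c f; congr pair; first exact: addr0.
by apply/ffunP => d; rewrite !ffunE /= subr0 addr0.
Qed.

Lemma wr_mulV : left_inverse wr_one wr_inv wr_mul.
Proof.
case=> c f; congr pair; first exact: addNr.
by apply/ffunP => d; rewrite !ffunE /= subrK addNr.
Qed.

Lemma wr_mulrV : right_inverse wr_one wr_inv wr_mul.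
Proof.
case=> c f; congr pair; first exact: addrN.
by apply/ffunP => d; rewrite !ffunE /= opprK subrr.
Qed.

HB.instance Definition _ :=
  isGroup.Build wreath wr_mulA wr_mul1 wr_mulr1 wr_mulV wr_mulrV.

Definition wr_top (c : C) : wreath := (c, 0).
Definition wr_base (a : A) : wreath := (0, [ffun d => a *+ (d == 0)]).

End Wreath.

(* The homomorphism induced by h : C -> D on the top groups: on the base groups
   it adds up the coordinates along the fibres of h. *)
Definition wr_map (A : zmodType) (C D : finZmodType) (h : C -> D)
    (u : wreath A C) : wreath A D :=
  (h u.1, [ffun e => (\sum_(d | h d == e) u.2 d)%R]).

Lemma wr_mapM (A : zmodType) (C D : finZmodType) (h : C -> D) :
  {morph h : c d / (c + d)%R} -> {morph @wr_map A C D h : u v / u * v}.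
Proof.
move=> hD u v; congr pair; first exact: hD.
apply/ffunP => e; rewrite !ffunE /=.
under eq_bigr do rewrite ffunE.
rewrite big_split /=; congr (_ + _)%R.
rewrite (reindex_inj (addIr v.1)) /=.
apply: eq_big => [d|d _]; last by rewrite addrK.
by rewrite hD [in RHS]eq_sym subr_eq eq_sym.
Qed.

(* The cyclic group C_{p^k}; the shape of the bound makes this right for k = 0
   as well. *)
Definition cyc (p k : nat) : finZmodType := 'I_(p ^ k).-1.+1.

Definition cyc_red (p k : nat) (c : cyc p k.+1) : cyc p k := inZp c.

Fact cyc_dvd p k : ((p ^ k).-1.+1 %| (p ^ k.+1).-1.+1)%N.
Proof.
case: p => [|p]; first by case: k => [|k] //; rewrite !exp0n ?dvdnn.
by rewrite !prednK ?expn_gt0// expnS dvdn_mull.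
Qed.

Lemma cyc_redD p k : {morph @cyc_red p k : c d / (c + d)%R}.
Proof.
move=> c d; apply/val_inj.
by rewrite /= modn_dvdm ?cyc_dvd// modnDm.
Qed.

Definition cyc_wreath (p k : nat) := wreath 'F_p (cyc p k).

Definition cyc_wreath_red (p k : nat) :
  cyc_wreath p k.+1 -> cyc_wreath p k := wr_map (@cyc_red p k).

Lemma cyc_wreath_redM p k : {morph @cyc_wreath_red p k : u v / u * v}.
Proof. exact/wr_mapM/cyc_redD. Qed.

Section ProWreath.
Variable p : nat.

Definition wr_prod :=
  prod_topology (fun k => discrete_topology (cyc_wreath p k)).

Definition wr_compat (w : wr_prod) : bool :=
  `[< forall k, cyc_wreath_red (w k.+1) = w k >].

(* The inverse limit of the C_p wr C_{p^k}. *)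
Definition pro_wreath : Type :=
  initial_topology (fun w : {w : wr_prod | wr_compat w} => val w).

HB.instance Definition _ := Topological.on pro_wreath.

Definition pw_val (w : pro_wreath) : wr_prod := sval w.

Lemma pw_inj (u v : pro_wreath) : (forall k, pw_val u k = pw_val v k) -> u = v.
Proof.
by move=> uv; apply/val_inj/functional_extensionality_dep.
Qed.

Lemma pw_compat (w : pro_wreath) k :
  cyc_wreath_red (pw_val w k.+1) = pw_val w k.
Proof. by move: k; apply/asboolP; case: w. Qed.

Definition pw_build (w : wr_prod)
  (h : forall k, cyc_wreath_red (w k.+1) = w k) : pro_wreath :=
  exist _ w (introT (asboolP _) h).

Fact pw_one_subproof k :
  cyc_wreath_red (1 : cyc_wreath p k.+1) = (1 : cyc_wreath p k).
Proof.
by apply: (@mulgI _ (cyc_wreath_red 1)); rewrite -cyc_wreath_redM !mulg1.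
Qed.

Fact pw_mul_subproof (u v : pro_wreath) k :
  cyc_wreath_red ((pw_val u k.+1 : cyc_wreath p k.+1) * pw_val v k.+1) =
  (pw_val u k : cyc_wreath p k) * pw_val v k.
Proof. by rewrite cyc_wreath_redM !pw_compat. Qed.

Fact pw_inv_subproof (u : pro_wreath) k :
  cyc_wreath_red ((pw_val u k.+1 : cyc_wreath p k.+1)^-1) =
  (pw_val u k : cyc_wreath p k)^-1.
Proof.
apply/esym/mulg1_eq; rewrite -(pw_compat u) -cyc_wreath_redM mulgV.
exact: pw_one_subproof.
Qed.

Definition pw_one := @pw_build (fun k => 1 : cyc_wreath p k) pw_one_subproof.
Definition pw_mul (u v : pro_wreath) :=
  @pw_build (fun k => (pw_val u k : cyc_wreath p k) * pw_val v k)
    (pw_mul_subproof u v).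
Definition pw_inv (u : pro_wreath) :=
  @pw_build (fun k => (pw_val u k : cyc_wreath p k)^-1) (pw_inv_subproof u).

Lemma pw_mulA : associative pw_mul.
Proof. by move=> u v w; apply: pw_inj => k; exact: mulgA. Qed.
Lemma pw_mul1 : left_id pw_one pw_mul.
Proof. by move=> u; apply: pw_inj => k; exact: mul1g. Qed.
Lemma pw_mulr1 : right_id pw_one pw_mul.
Proof. by move=> u; apply: pw_inj => k; exact: mulg1. Qed.
Lemma pw_mulV : left_inverse pw_one pw_inv pw_mul.
Proof. by move=> u; apply: pw_inj => k; exact: mulVg. Qed.
Lemma pw_mulrV : right_inverse pw_one pw_inv pw_mul.
Proof. by move=> u; apply: pw_inj => k; exact: mulgV. Qed.

HB.instance Definition _ :=
  isGroup.Build pro_wreath pw_mulA pw_mul1 pw_mulr1 pw_mulV pw_mulrV.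

Lemma pw_val_continuous k :
  continuous (fun w : pro_wreath =>
    pw_val w k : discrete_topology (cyc_wreath p k)).
Proof.
move=> w; apply: (@continuous_comp _ _ _ pw_val (@^~ k)).
  exact: initial_continuous.
exact: (@proj_continuous _ (fun k => discrete_topology (cyc_wreath p k))).
Qed.

Lemma pw_continuous (X : topologicalType) (f : X -> pro_wreath) :
  (forall k, continuous
    (fun x => pw_val (f x) k : discrete_topology (cyc_wreath p k))) ->
  continuous f.
Proof.
move=> cf; apply: continuous_comp_initial => x; apply/cvg_sup => k.
by apply: (@continuous_comp_initial _ _ _ (fun w : wr_prod => w k)); exact: cf.
Qed.

Lemma pw_mulg_continuous :
  continuous (fun w : pro_wreath * pro_wreath => w.1 * w.2).
Proof.
apply: pw_continuous => k [u v] A /nbhs_singleton /= Auv.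
have nk (w : pro_wreath) : nbhs w [set w' | pw_val w' k = pw_val w k].
  apply: (@pw_val_continuous k w
    [set c : discrete_topology (cyc_wreath p k) | c = pw_val w k]).
  exact: discrete_set1.
exists ([set w | pw_val w k = pw_val u k], [set w | pw_val w k = pw_val v k]).
  by split; exact: nk.
move=> [u' v'] /= [eu ev]; move: Auv.
by rewrite /= eu ev.
Qed.

Lemma pw_invg_continuous : continuous (fun w : pro_wreath => w^-1).
Proof.
apply: pw_continuous => k u A /nbhs_singleton /= Au.
have : nbhs u [set w' | pw_val w' k = pw_val u k].
  apply: (@pw_val_continuous k u
    [set c : discrete_topology (cyc_wreath p k) | c = pw_val u k]).
  exact: discrete_set1.
by apply: filterS => w /= ->.
Qed.

Lemma pw_hausdorff : hausdorff_space pro_wreath.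
Proof.
move=> u v uv; apply: pw_inj => k.
have nk (w : pro_wreath) : nbhs w [set w' | pw_val w' k = pw_val w k].
  apply: (@pw_val_continuous k w
    [set c : discrete_topology (cyc_wreath p k) | c = pw_val w k]).
  exact: discrete_set1.
by have [w [/= <- <-]] := uv _ _ (nk u) (nk v).
Qed.

HB.instance Definition _ :=
  isTopologicalGroup.Build pro_wreath pw_mulg_continuous pw_invg_continuous.

Fact cyc_red1 k : cyc_red (inZp 1 : cyc p k.+1) = inZp 1.
Proof. by apply/val_inj; rewrite /= modn_dvdm ?cyc_dvd. Qed.

Fact cyc_red0 k : cyc_red (0%R : cyc p k.+1) = 0%R.
Proof. by apply/val_inj; rewrite /= mod0n. Qed.

Fact pw_x_subproof k :
  cyc_wreath_red (wr_top 'F_p (inZp 1 : cyc p k.+1)) =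
  wr_top 'F_p (inZp 1 : cyc p k).
Proof.
congr pair; first exact: cyc_red1.
by apply/ffunP => e; rewrite !ffunE big1// => d _; rewrite ffunE.
Qed.

Fact pw_y_subproof k :
  cyc_wreath_red (wr_base (cyc p k.+1) (1 : 'F_p)%R) =
  wr_base (cyc p k) (1 : 'F_p)%R.
Proof.
congr pair; first exact: cyc_red0.
apply/ffunP => e; rewrite !ffunE big_mkcond (bigD1 0%R)//= big1.
  by rewrite cyc_red0 ffunE eqxx addr0 eq_sym; case: eqP.
by move=> d d0; rewrite ffunE (negPf d0) mulr0n if_same.
Qed.

Definition pw_x :=
  @pw_build (fun k => wr_top 'F_p (inZp 1 : cyc p k)) pw_x_subproof.
Definition pw_y :=
  @pw_build (fun k => wr_base (cyc p k) (1 : 'F_p)%R) pw_y_subproof.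

Definition pw_B : set pro_wreath :=
  closed_generated (range (fun i : int => pw_y ^ expgz pw_x i)).

End ProWreath.

Lemma conjg_continuous (T : topGroupType) (v : T) :
  continuous (fun u : T => u ^ v).
Proof.
move=> u; apply: (@continuous_comp _ _ _ (fun w : T => w * v)
  (fun w : T => v^-1 * w)); last exact: mulgl_continuous.
exact: mulgr_continuous.
Qed.

Lemma closed_generated_normal (T : topGroupType) (A : set T) :
  (forall u v, A u -> A (u ^ v)) -> normal_subgroup (closed_generated A).
Proof.
move=> AJ; split; first split.
- by move=> K [[]].
- move=> u v Ku Kv K hK; case: (hK) => -[_ KM _] _ _.
  by apply: KM; [exact: Ku|exact: Kv].
- move=> u Ku K hK; case: (hK) => -[_ _ KV] _ _.
  by apply: KV; exact: Ku.
- move=> u v Ku K [[K1 KM KV] cK AK].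
  apply: (Ku ((fun w => w ^ v) @^-1` K)); split=> /=.
  + split=> /=; first by rewrite conj1g.
      by move=> a b Ka Kb; rewrite conjMg; exact: KM.
    by move=> a Ka; rewrite conjVg; exact: KV.
  + by apply: preimage_closed => // w _; exact: conjg_continuous.
  + by move=> a Aa; apply: AK; exact: AJ.
Qed.

Section Extension.
Variables (p : nat) (F : topGroupType).
Variable phi : {multiplicative F -> pro_wreath p}.

Lemma kernel_normal : normal_subgroup (phi @^-1` [set 1]).
Proof.
have phi1 : phi 1 = 1.
  by apply: (@mulgI _ (phi 1)); rewrite -gmulfM !mulg1.
have phiV u : phi u^-1 = (phi u)^-1.
  by apply/esym/mulg1_eq; rewrite -gmulfM mulgV.
split; first split => //=.
- by move=> u v eu ev; rewrite gmulfM eu ev mulg1.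
- by move=> u eu; rewrite phiV eu invg1.
- by move=> u v /= eu; rewrite !gmulfM eu mul1g -gmulfM mulVg.
Qed.

Definition kerR : normalSubgroup F := NormalSubgroup kernel_normal.

Definition kerN_gens : set F :=
  [set [~ r, f] | r in nsub_set kerR & f in setT] `|`
  [set r ^+ p | r in nsub_set kerR].

Lemma kerN_normal : normal_subgroup (closed_generated kerN_gens).
Proof.
case: kernel_normal => _ RJ.
apply: closed_generated_normal => u v [[r Rr [f _ <-]]|[r Rr <-]].
  left; exists (r ^ v); first exact: RJ.
  by exists (f ^ v) => //; rewrite conjRg.
right; exists (r ^ v); first exact: RJ.
by rewrite conjXg.
Qed.

Definition kerN : normalSubgroup F := NormalSubgroup kerN_normal.

Definition extG : topGroupType := quo kerN.

Definition extZ : set extG := \pi_extG%qT @` nsub_set kerR.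

(* The map G -> W induced by phi, with kernel Z; see extG_projE. *)
Definition extG_proj (g : extG) : pro_wreath p := phi (repr g).

Definition extH : set extG := extG_proj @^-1` @pw_B p.

Lemma kerR_closed : continuous phi -> closed (nsub_set kerR).
Proof.
move=> cphi; apply: preimage_closed => [u _|]; first exact: cphi.
exact/accessible_closed_set1/hausdorff_accessible/pw_hausdorff.
Qed.

Lemma kerN_sub : continuous phi -> nsub_set kerN `<=` nsub_set kerR.
Proof.
move=> cphi u Nu; case: (kernel_normal) => Rg RJ.
apply: Nu; split; [exact: Rg|exact: kerR_closed|].
case: Rg => R1 RM RV.
move=> _ [[r Rr [f _ <-]]|[r Rr <-]].
  by apply: RM; [exact: RV|exact: RJ].
by elim: p => [//|n IHn]; rewrite expgS; exact: RM.
Qed.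

Lemma extG_projE (f : F) :
  continuous phi -> extG_proj (\pi_extG%qT f) = phi f.
Proof.
move=> cphi.
have /quo_eqP/(kerN_sub cphi) : \pi_extG%qT (repr (\pi_extG%qT f)) = \pi_extG%qT f.
  by rewrite reprK.
rewrite /extG_proj; set g := repr _ => e.
by rewrite -[f in RHS](mulVKg g) gmulfM (e : phi _ = 1) mulg1.
Qed.

End Extension.

Arguments extZ {p F} phi _.
Arguments extH {p F} phi _.
Arguments hspec_normal R p {T} S _.

(* Main.v *)
(* Write G = F/N and H for the preimage of B, and let K be a closed normal
   subgroup of G.
   - If K <= Z, then hdim K <= xi.  As Z is central and elementary abelian, every
     sequence of dimensions log|K S_n : S_n| whose increments are bounded by
     those of log|Z S_n : S_n| is realised by some K <= Z; the sequence
     floor(b log|Z S_n : S_n|) gives hdim K = b xi for each b in [0,1].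
   - If K <= H but not K <= Z, the image of K in F_p[[t]] is a nonzero ideal and
     contains t^q = (1+t)^q - 1 for some q = p^k, so y^(x^q) = y u z with u in K
     and z in Z.  Modulo K, the conjugates y^(x^i), i < q, together with z, y^p
     and the [y, y^(x^i)], i < q, generate a finite normal subgroup, which is
     the image of H since G modulo the closed normal subgroup generated by y is
     procyclic.  So |H : K| is finite and hdim K = eta.
   - Otherwise pick u in K outside H.  Then [y, u] lies in K and H but not in Z,
     so |H : H cap K| is finite by the previous case; as KH/H is a nontrivial
     closed subgroup of Z_p, K has finite index in G and hdim K = 1. *)

From HB Require Import structures.
Require Import Defs.
From mathcomp Require Import all_boot all_order all_algebra.
From mathcomp Require Import finmap lra.
From mathcomp Require Import all_classical all_reals all_analysis.

Set Implicit Arguments.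
Unset Strict Implicit.
Unset Printing Implicit Defensive.

Import Order.TTheory GRing.Theory Num.Theory.
Import numFieldNormedType.Exports.

Local Open Scope classical_set_scope.
Local Open Scope group_scope.

(** * Cosets and indices *)

(** The series [S] is arbitrary, and exponents in Z_p never appear as such. Membership in a closed
    set is tested modulo each [S n] ([closed_filtrationP]), where x has p-power order and natural
    exponents suffice. This works only if the exponents found do not depend on n, which is the
    delicate point of both finite-index cases. When K lies in H, the ideal argument is made at every
    finite level m, in F_p[X]/(X^(p^m) - 1) with X = 1 + t. Ideals there are generated by powers of
    X - 1, so an element that is nonzero at level k generates one containing X^(p^k) - 1, with the
    same k for all m. The elements of K obtained this way do depend on m; compactness of K replaces
    them by a single one. When K is not in H, a level j at which some u in K has nonzero top
    coordinate bounds the power of x. Dimensions are compared through numerators that differ by a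
    bounded amount: log_p |G : S_n| tends to infinity because x has image of order p^k in C_(p^k)
    for every k, so such errors vanish in the limit. The error is at most |H : K| or |G : K| for a
    subgroup of finite index, and less than 1 for the rounding in floor(b log|Z S_n : S_n|). *)

Lemma cardfs_prod (U V : choiceType) (A : {fset U}) (B : {fset V}) :
  #|` (A `*` B)%fset| = (#|` A| * #|` B|)%N.
Proof.
rewrite -(size_allpairs pair); apply/perm_size/uniq_perm => //.
  by apply: allpairs_uniq => // -[u v] [u' v'].
move=> [u v]; rewrite in_fsetM/=; apply/andP/allpairsP => /=.
  by move=> [uA vB]; exists (u, v).
by move=> [[a b] [/= aA bB [-> ->]]].
Qed.

Section Index.
Variable T : groupType.
Implicit Types K L M S : set T.

Definition cosets K L := [set lcoset u L | u in K].

(** L need not lie in K: for a subgroup L, the cosets of L that meet K are those making up KL.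
    Finiteness is tracked apart from [gindex] because the junk value 0 breaks monotonicity. *)
Definition fin_index K L := finite_set (cosets K L).

Lemma subgroupT : subgroup [set: T].
Proof. by []. Qed.

Lemma subgroup1 : subgroup [set (1 : T)].
Proof.
by split=> //= [u v -> ->|u ->]; rewrite ?mulg1 ?invg1.
Qed.

Lemma subgroupX K u n : subgroup K -> K u -> K (u ^+ n).
Proof.
case=> K1 KM _ Ku; elim: n => [//|n IHn].
by rewrite expgS; exact: KM.
Qed.

Lemma subgroup_gcd_exp K u a b : subgroup K -> (0 < a)%N ->
  K (u ^+ a) -> K (u ^+ b) -> K (u ^+ gcdn a b).
Proof.
move=> sK a0 Ka Kb; have [_ KM KV] := sK.
(* Bezout in natural numbers, k a = m b + gcd(a, b); the term m b is moved over as an inverse. *)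
case: (egcdnP b a0) => k m km _.
have -> : u ^+ gcdn a b = (u ^+ b) ^- m * (u ^+ a) ^+ k.
  by rewrite -!expgnA [(a * k)%N]mulnC km [(m * b)%N]mulnC expgnDr mulKg.
by apply: KM; [apply: KV|]; exact: subgroupX.
Qed.

Lemma subgroupI K L : subgroup K -> subgroup L -> subgroup (K `&` L).
Proof.
move=> [K1 KM KV] [L1 LM LV]; split=> //.
- by move=> u v [? ?] [? ?]; split; [exact: KM|exact: LM].
- by move=> u [? ?]; split; [exact: KV|exact: LV].
Qed.

Lemma normal_subgroupI K L :
  normal_subgroup K -> normal_subgroup L -> normal_subgroup (K `&` L).
Proof.
move=> [sK KJ] [sL LJ]; split; first exact: subgroupI.
by move=> u v [? ?]; split; [exact: KJ|exact: LJ].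
Qed.

Lemma subgroup_mul K S : subgroup K -> normal_subgroup S ->
  subgroup (mul_set K S).
Proof.
move=> [K1 KM KV] [[S1 SM SV] SJ]; split.
- by exists 1 => //; exists 1 => //; rewrite mulg1.
- move=> _ _ [a Ka [s Ss <-]] [b Kb [t St <-]].
  exists (a * b); first exact: KM.
  exists (s ^ b * t); first by apply: SM => //; exact: SJ.
  by rewrite conjgE !mulgA mulgK.
- move=> _ [a Ka [s Ss <-]]; exists a^-1; first exact: KV.
  exists (s^-1 ^ a^-1); first by apply: SJ; exact: SV.
  by rewrite conjgE invgK mulKg invgM.
Qed.

Lemma normal_subgroup_mul K S : normal_subgroup K -> normal_subgroup S ->
  normal_subgroup (mul_set K S).
Proof.
move=> [sK KJ] nS; split; first exact: subgroup_mul.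
case: nS => _ SJ _ v [a Ka [s Ss <-]]; rewrite conjMg.
by exists (a ^ v); [exact: KJ|exists (s ^ v) => //; exact: SJ].
Qed.

Lemma mul_setl K S : S 1 -> K `<=` mul_set K S.
Proof. by move=> S1 u Ku; exists u => //; exists 1 => //; rewrite mulg1. Qed.

Lemma mul_setr K S : K 1 -> S `<=` mul_set K S.
Proof. by move=> K1 u Su; exists 1 => //; exists u => //; rewrite mul1g. Qed.

Lemma mul_setS K L S : K `<=` L -> mul_set K S `<=` mul_set L S.
Proof. by move=> KL _ [u Ku [s Ss <-]]; exists u; [exact: KL|exists s]. Qed.

Lemma mul_set_min K S L : subgroup L -> K `<=` L -> S `<=` L ->
  mul_set K S `<=` L.
Proof.
by move=> [_ LM _] KL SL _ [u Ku [s Ss <-]]; apply: LM; [exact: KL|exact: SL].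
Qed.

Lemma mul_setTl S : S 1 -> mul_set setT S = setT.
Proof. by move=> S1; apply/seteqP; split=> // u _; exact: mul_setl. Qed.

Lemma lcosetP L u v : subgroup L -> lcoset u L = lcoset v L <-> L (u^-1 * v).
Proof.
move=> [L1 LM LV]; split=> [e|Luv].
  have : lcoset v L v by exists 1 => //; rewrite mulg1.
  by rewrite -e => -[l Ll <-]; rewrite mulKg.
apply/seteqP; split=> _ [l Ll <-].
  exists ((u^-1 * v)^-1 * l); first by apply: LM => //; exact: LV.
  by rewrite invgM invgK !mulgA mulgV mul1g.
by exists (u^-1 * v * l); [exact: LM|rewrite !mulgA mulgV mul1g].
Qed.

Lemma cosets_id K : subgroup K -> cosets K K = [set K].
Proof.
move=> sK; have [K1 _ _] := sK.
have e1 : lcoset 1 K = K.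
  apply/seteqP; split=> [_ [v Kv <-]|v Kv]; first by rewrite mul1g.
  by exists v => //; rewrite mul1g.
apply/seteqP; split=> [_ [u Ku <-]|_ ->]; last by exists 1.
by rewrite /= -[RHS]e1; apply/esym/lcosetP => //; rewrite invg1 mul1g.
Qed.

Lemma gindex_id K : subgroup K -> gindex K K = 1%N.
Proof.
by move=> sK; rewrite /gindex -/(cosets K K) cosets_id// fset_set1 cardfs1.
Qed.

Lemma fin_indexS K K' L : K `<=` K' -> fin_index K' L -> fin_index K L.
Proof. by move=> KK'; apply: sub_finite_set; exact: image_subset. Qed.

Lemma gindexS K K' L : K `<=` K' -> fin_index K' L ->
  (gindex K L <= gindex K' L)%N.
Proof.
move=> KK' f; apply: fsubset_leq_card.
rewrite -fset_set_sub; [exact: image_subset|exact: fin_indexS f|exact: f].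
Qed.

Lemma lcoset_mul u L M : subgroup L -> M `<=` L -> M 1 ->
  mul_set (lcoset u M) L = lcoset u L.
Proof.
move=> [L1 LM LV] ML M1; apply/seteqP; split.
  by move=> _ [_ [m /ML Lm <-] [l Ll <-]]; exists (m * l);
    [exact: LM|rewrite mulgA].
by move=> _ [l Ll <-]; exists u; [exists 1; rewrite ?mulg1|exists l].
Qed.

Lemma cosetsW K L M : subgroup L -> M `<=` L -> M 1 ->
  cosets K L = (fun C => mul_set C L) @` cosets K M.
Proof.
move=> sL ML M1; rewrite /cosets image_comp; apply: eq_imagel => u Ku /=.
by rewrite lcoset_mul.
Qed.

Lemma fin_indexW K L M : subgroup L -> M `<=` L -> M 1 ->
  fin_index K M -> fin_index K L.
Proof. by move=> sL ML M1 f; rewrite /fin_index (cosetsW _ sL ML M1);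
  exact: finite_image. Qed.

Lemma gindex_image (U : choiceType) (A : set U) (f : U -> set T) K L :
  cosets K L = f @` A -> {in A &, injective f} -> finite_set A ->
  gindex K L = #|` fset_set A|.
Proof.
move=> e fi Af; rewrite /gindex -/(cosets K L) e fset_set_image//.
rewrite card_in_imfset//= => u v; rewrite !in_fset_set// => uA vA.
by apply: fi.
Qed.

(** This exploits the junk value: an infinite index would be 0. *)
Lemma fin_index_gindex K L : (0 < gindex K L)%N -> fin_index K L.
Proof.
move=> h; apply: contrapT => nf; move: h.
by rewrite /gindex /fset_set; case: pselect => // _; rewrite cardfs0.
Qed.

(** The bijection sends (C, D) to r(C) D, where r(C) is a chosen representative of C. It is
    injective because the M-coset of r(C) v determines the L-coset C, hence r(C), hence v M. *)
Lemma cosetsM K L M : subgroup K -> subgroup L -> subgroup M ->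
  M `<=` L -> L `<=` K -> exists f : set T * set T -> set T,
  cosets K M = f @` (cosets K L `*` cosets L M) /\
  {in cosets K L `*` cosets L M &, injective f}.
Proof.
move=> sK sL sM ML LK; have [K1 KM KV] := sK; have [L1 LM LV] := sL.
have [M1 MM MV] := sM.
pose r C := xget (1 : T) [set u | K u /\ lcoset u L = C].
have rP C : cosets K L C -> K (r C) /\ lcoset (r C) L = C.
  move=> [u Ku e]; rewrite /r.
  have := @xgetPex T 1 [set u | K u /\ lcoset u L = C].
  by apply; exists u.
pose f CD : set T := [set r CD.1 * d | d in CD.2].
have fE C v : f (C, lcoset v M) = lcoset (r C * v) M.
  apply/seteqP; split=> /=.
    by move=> _ [_ [m Mm <-] <-]; exists m => //; rewrite mulgA.
  by move=> _ [m Mm <-]; exists (v * m); [exists m|rewrite mulgA].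
exists f; split.
  apply/seteqP; split.
    move=> _ [u Ku <-];
      have [Kr er] := rP (lcoset u L) (ex_intro2 _ _ u Ku erefl).
    exists (lcoset u L, lcoset ((r (lcoset u L))^-1 * u) M).
      split=> /=; first by exists u.
      by exists ((r (lcoset u L))^-1 * u) => //; exact/lcosetP.
    by rewrite fE mulVKg.
  move=> _ [[C _] [/= CKL [v Lv <-]] <-]; rewrite fE.
  exists (r C * v) => //; apply: KM; last exact: LK.
  by have [] := rP _ CKL.
move=> [C _] [C' _] /set_mem[/= hC [v Lv <-]] /set_mem[/= hC' [v' Lv' <-]].
rewrite !fE => e.
have [Kr er] := rP _ hC; have [Kr' er'] := rP _ hC'.
have : M ((r C * v)^-1 * (r C' * v')) by apply/lcosetP.
move=> Mvv.
have CC' : C = C'.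
  rewrite -er -er'; apply/(lcosetP _ _ sL).
  have -> : (r C)^-1 * r C' = v * ((r C * v)^-1 * (r C' * v')) * v'^-1.
    by rewrite invgM !mulgA mulgV mul1g mulgK.
  by apply: (LM); [apply: (LM) => //; exact: ML|exact: LV].
congr pair => //; apply/(lcosetP _ _ sM); move: Mvv.
by rewrite CC' invgM !mulgA mulgVK.
Qed.

Lemma fin_indexM K L M : subgroup K -> subgroup L -> subgroup M ->
  M `<=` L -> L `<=` K -> fin_index K L -> fin_index L M -> fin_index K M.
Proof.
move=> sK sL sM ML LK f g; rewrite /fin_index.
have [h [-> _]] := cosetsM sK sL sM ML LK.
by apply: finite_image; exact: finite_setX.
Qed.

Lemma gindexM K L M : subgroup K -> subgroup L -> subgroup M ->
  M `<=` L -> L `<=` K -> fin_index K M ->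
  gindex K M = (gindex K L * gindex L M)%N.
Proof.
move=> sK sL sM ML LK f.
have f1 : fin_index K L by apply: fin_indexW f => //; case: sM.
have f2 : fin_index L M by exact: fin_indexS f.
have [h [e hi]] := cosetsM sK sL sM ML LK.
rewrite (gindex_image e hi); last exact: finite_setX.
by rewrite fset_setX// cardfs_prod.
Qed.

Lemma cosets_mul K S : subgroup S -> cosets (mul_set K S) S = cosets K S.
Proof.
move=> sS; have [S1 SM SV] := sS; apply/seteqP; split.
  move=> _ [_ [k Kk [s Ss <-]] <-]; exists k => //; apply/lcosetP => //.
  by rewrite mulKg.
by apply: image_subset; exact: mul_setl.
Qed.

Lemma gindex_mul K S : subgroup S -> gindex (mul_set K S) S = gindex K S.
Proof. by move=> sS; rewrite /gindex -!/(cosets _ _) cosets_mul. Qed.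

(** The second isomorphism theorem on cosets: two elements of K congruent modulo S are congruent
    modulo K ∩ S. *)
Lemma lcoset_setI_inj K S : subgroup K -> subgroup S ->
  {in cosets K (K `&` S) &, injective (fun C => mul_set C S)}.
Proof.
move=> sK sS; have [K1 KM KV] := sK; have [S1 _ _] := sS.
have sKS := subgroupI sK sS.
move=> _ _ /set_mem[u Ku <-] /set_mem[v Kv <-].
rewrite !lcoset_mul// => /(lcosetP _ _ sS) Suv; apply/(lcosetP _ _ sKS).
by split=> //; apply: KM => //; exact: KV.
Qed.

Lemma fin_index_setI K S : subgroup K -> subgroup S -> fin_index K S ->
  fin_index K (K `&` S).
Proof.
move=> sK sS; have [K1 _ _] := sK; have [S1 _ _] := sS.
rewrite /fin_index (@cosetsW K S (K `&` S))//.
by rewrite (eq_finite_set (inj_card_eq _))//; exact: lcoset_setI_inj.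
Qed.

Lemma gindex_setI K S : subgroup K -> subgroup S -> fin_index K (K `&` S) ->
  gindex K S = gindex K (K `&` S).
Proof.
move=> sK sS f; have [K1 _ _] := sK; have [S1 _ _] := sS.
apply: (gindex_image (@cosetsW K S (K `&` S) _ _ _)) => //.
exact: lcoset_setI_inj.
Qed.

Lemma gindex_trivI K S : subgroup K -> subgroup S -> K `&` S `<=` [set 1] ->
  fin_index K [set 1] -> gindex K S = gindex K [set 1].
Proof.
move=> sK sS KS f; have [K1 _ _] := sK; have [S1 _ _] := sS.
have e : K `&` S = [set 1] by apply/seteqP; split=> // _ ->.
by rewrite gindex_setI// e.
Qed.

(** Every coset of KS in LS meets L, so |LS : KS| is at most |L : K|. The bound is the same for all
    S, so passing to a subgroup of finite index will not change the dimension. *)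
Lemma leq_gindex_mul K L S : subgroup K -> subgroup L -> normal_subgroup S ->
  K `<=` L -> fin_index L K -> fin_index setT S ->
  (gindex (mul_set L S) S <= gindex L K * gindex (mul_set K S) S)%N.
Proof.
move=> sK sL nS KL fLK fS; have [sS SJ] := nS; have [S1 _ _] := sS.
have [K1 _ _] := sK; have sKS := subgroup_mul sK nS.
have [L1 _ _] := sL; have sLS := subgroup_mul sL nS.
rewrite (@gindexM _ (mul_set K S) S)//; last 3 first.
- exact: mul_setr.
- exact: mul_setS.
- exact: fin_indexS fS.
rewrite leq_mul2r; apply/orP; right.
have -> : gindex (mul_set L S) (mul_set K S) = gindex L (mul_set K S).
  rewrite /gindex; congr (#|` fset_set _ |); apply/seteqP; split.
    move=> _ [_ [l Ll [s Ss <-]] <-]; exists l => //; apply/lcosetP => //.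
    by rewrite mulKg; exact: mul_setr.
  by apply: image_subset; exact: mul_setl.
rewrite /gindex -!/(cosets _ _) (cosetsW L sKS (mul_setl S1) K1).
by rewrite fset_set_image//; exact: leq_imfset_card.
Qed.

End Index.

(** * Extension of a subgroup by one element normalising it *)

Section CyclicExtension.
Variables (T : groupType) (L : set T) (e : T).
Hypotheses (sL : subgroup L) (LJ : forall u, L u -> L (u ^ e)).

(** The subgroup generated by L and e once some positive power of e lies in L; negative powers of e
    are then redundant. *)
Definition cyc_ext : set T := [set e ^+ a * l | a in [set: nat] & l in L].

Lemma cyc_ext_sub : L `<=` cyc_ext.
Proof. by move=> l Ll; exists 0%N => //; exists l => //; rewrite mul1g. Qed.

Lemma cyc_ext_gen : cyc_ext e.
Proof.
by case: sL => L1 _ _; exists 1%N => //; exists 1 => //; rewrite mulg1.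
Qed.

Lemma cyc_ext_min (M : set T) : subgroup M -> L `<=` M -> M e -> cyc_ext `<=` M.
Proof.
move=> sM LM Me _ [a _ [l Ll <-]]; have [_ MM _] := sM; apply: MM.
  exact: subgroupX.
exact: LM.
Qed.

Let LJX u a : L u -> L (u ^ (e ^+ a)).
Proof.
move=> Lu; elim: a => [|a IHa]; first by rewrite conjg1.
by rewrite expgSr conjgM; exact: LJ.
Qed.

Lemma cyc_ext_subgroup d : (0 < d)%N -> L (e ^+ d) -> subgroup cyc_ext.
Proof.
move=> d0 Led; have [L1 LM LV] := sL; split; first exact: cyc_ext_sub.
  move=> _ _ [a _ [l Ll <-]] [b _ [m Lm <-]].
  exists (a + b)%N => //; exists (l ^ (e ^+ b) * m).
    by apply: LM => //; exact: LJX.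
  by rewrite conjgE expgnDr !mulgA mulgK.
move=> _ [a _ [l Ll <-]].
(* a (d - 1) is congruent to -a modulo d; the factor (e^d)^(-a), which lies in L, makes up the
   difference. *)
exists (a * d.-1)%N => //; exists (l^-1 ^ (e ^+ (a * d.-1)) * (e ^+ d) ^- a).
apply: LM; first by apply: LJX; exact: LV.
  by apply: LV; exact: subgroupX.
rewrite conjgE invgM -mulgA.
have -> : (e ^+ d) ^+ a = e ^+ a * e ^+ (a * d.-1).
  by rewrite -expgnA -expgnDr mulnC -mulnS prednK.
by rewrite invgM !mulgA mulgV mul1g mulgK.
Qed.

Let cosetX d a l : L (e ^+ d) -> L l ->
  lcoset (e ^+ a * l) L = lcoset (e ^+ (a %% d)) L.
Proof.
move=> Led Ll; have [L1 LM LV] := sL; apply/esym/lcosetP => //.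
rewrite {2}(divn_eq a d) addnC expgnDr !mulgA mulVg mul1g mulnC expgnA.
by apply: LM => //; exact: subgroupX.
Qed.

Let cosets_cyc_ext d : (0 < d)%N -> L (e ^+ d) ->
  cosets cyc_ext L = (fun a => lcoset (e ^+ a) L) @` `I_d.
Proof.
move=> d0 Led; have [L1 LM LV] := sL; apply/seteqP; split.
  move=> _ [_ [a _ [l Ll <-]] <-]; rewrite (cosetX a Led Ll).
  by exists (a %% d)%N => //=; rewrite ltn_mod.
move=> _ [a _ <-]; exists (e ^+ a) => //.
by exists a => //; exists 1 => //; rewrite mulg1.
Qed.

Lemma fin_index_cyc_ext d : (0 < d)%N -> L (e ^+ d) -> fin_index cyc_ext L.
Proof.
move=> d0 Led; rewrite /fin_index (cosets_cyc_ext d0 Led).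
exact/finite_image/finite_II.
Qed.

Lemma gindex_cyc_ext d : (0 < d)%N -> L (e ^+ d) ->
  (forall a, (0 < a < d)%N -> ~ L (e ^+ a)) -> gindex cyc_ext L = d.
Proof.
move=> d0 Led dmin; have [L1 LM LV] := sL.
rewrite (gindex_image (cosets_cyc_ext d0 Led)).
- exact: card_fset_set.
- suff H a b : (a <= b)%N -> (b < d)%N ->
      lcoset (e ^+ a) L = lcoset (e ^+ b) L -> a = b.
    move=> a b /set_mem/= ad /set_mem/= bd ab.
    by case/orP: (leq_total a b) => [/H|/H h]; [exact|apply/esym/h].
  move=> ab bd /(lcosetP _ _ sL); rewrite -{1}(subnKC ab) expgnDr mulKg.
  move=> Lba; apply/eqP; rewrite eqn_leq ab /= -subn_eq0 -leqn0 leqNgt.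
  apply/negP => h; apply: dmin Lba; rewrite h /=.
  by apply: leq_ltn_trans bd; exact: leq_subr.
- exact: finite_II.
Qed.

End CyclicExtension.

(** * Subgroups and indices along morphisms *)

Section Morphism.
Variables (T U : groupType) (f : T -> U).
Hypothesis fM : {morph f : u v / u * v}.

Lemma morph_one : f 1 = 1.
Proof. by apply: (@mulgI _ (f 1)); rewrite -fM !mulg1. Qed.

Lemma morph_inv : {morph f : u / u^-1}.
Proof. by move=> u; apply/esym/mulg1_eq; rewrite -fM mulgV morph_one. Qed.

Lemma morph_exp n : {morph f : u / u ^+ n}.
Proof.
move=> u; elim: n => [|n IHn]; first exact: morph_one.
by rewrite !expgS fM IHn.
Qed.

Lemma morph_conj : {morph f : u v / u ^ v}.
Proof. by move=> u v; rewrite !conjgE !fM morph_inv. Qed.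

Lemma morph_comm : {morph f : u v / [~ u, v]}.
Proof. by move=> u v; rewrite !commgEl fM morph_inv morph_conj. Qed.

Lemma subgroup_preimage (K : set U) : subgroup K -> subgroup (f @^-1` K).
Proof.
move=> [K1 KM KV]; split=> /=; first by rewrite morph_one.
  by move=> u v; rewrite fM; exact: KM.
by move=> u; rewrite morph_inv; exact: KV.
Qed.

Lemma normal_subgroup_preimage (K : set U) :
  normal_subgroup K -> normal_subgroup (f @^-1` K).
Proof.
move=> [sK KJ]; split; first exact: subgroup_preimage.
by move=> u v /=; rewrite morph_conj; exact: KJ.
Qed.

Lemma gindex_preimage (K L : set U) : (forall v, exists u, f u = v) ->
  subgroup L ->
  gindex (f @^-1` K) (f @^-1` L) = gindex K L.
Proof.
move=> fsurj sL.
have e : cosets (f @^-1` K) (f @^-1` L) = (fun C => f @^-1` C) @` cosets K L.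
  have E u : lcoset u (f @^-1` L) = f @^-1` (lcoset (f u) L).
    apply/seteqP; split=> [_ [l /= Ll <-]|v /= [l Ll e]].
      by rewrite /= fM; exists (f l).
    by exists (u^-1 * v); rewrite ?mulVKg//= fM morph_inv -e mulKg.
  apply/seteqP; split=> [_ [u /= Ku <-]|_ [_ [v Kv <-] <-]].
    by rewrite E; exists (lcoset (f u) L) => //; exists (f u).
  by have [u uv] := fsurj v; rewrite -uv -E; exists u => //=; rewrite uv.
have i : injective (fun C : set U => f @^-1` C).
  move=> C D CD; apply/seteqP; split=> v; have [u <-] := fsurj v.
    by rewrite -[C (f u)]/((f @^-1` C) u) CD.
  by rewrite -[D (f u)]/((f @^-1` D) u) -CD.
(* For an infinite index both sides take the junk value 0. *)
have [h|h] := pselect (fin_index K L).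
  by apply: (gindex_image e) => // C D _ _; exact: i.
rewrite /gindex /fset_set; case: pselect => [h'|_]; last first.
  by case: pselect => [/h//|_]; rewrite !cardfs0.
case: h; rewrite -/(cosets _ _) e in h'.
by rewrite (eq_finite_set (inj_card_eq _)) in h' => // C D _ _; exact: i.
Qed.

End Morphism.

(** * Compact groups with a filtration series *)

Lemma compact_increasing_cover (X : topologicalType) (A : set X)
    (U : nat -> set X) : compact A -> (forall n, open (U n)) ->
  (forall n, U n `<=` U n.+1) -> A `<=` \bigcup_n U n ->
  exists n, A `<=` U n.
Proof.
move=> /compact_near_coveringP cA oU US AU.
have mono m n : (m <= n)%N -> U m `<=` U n.
  move=> mn; rewrite -(subnKC mn); elim: (n - m)%N => [|k IH];
    first by rewrite addn0.
  by rewrite addnS; apply: subset_trans (US _).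
suff [n _ h] : \forall n \near \oo, A `<=` U n.
  by exists n; apply: h => /=.
apply: (cA nat \oo (fun n x => U n x)) => x /AU[n _ Unx];
  exists (U n, [set m | (n <= m)%N]).
  split=> /=; last by exists n.
  by apply: open_nbhs_nbhs; split=> //; exact: oU.
by move=> [y m] [/= Uny nm]; exact: mono nm _ Uny.
Qed.

Lemma compact_decreasing_capI (X : topologicalType) (A : set X)
    (C : nat -> set X) : compact A -> (forall n, closed (C n)) ->
  (forall n, C n.+1 `<=` C n) -> (forall n, A `&` C n !=set0) ->
  A `&` \bigcap_n C n !=set0.
Proof.
move=> cA cC CS h; apply: contrapT => AC0.
have [n|n|x Ax|n An] := @compact_increasing_cover _ A (fun n => ~` C n) cA.
- exact: closed_openC.
- exact: subsetC.
- by apply: contrapT => nx; apply: AC0; exists x; split=> // n _;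
    apply: contrapT => nC; apply: nx; exists n.
- by have [x [/An]] := h n.
Qed.

Section OpenSubgroup.
Variable T : topGroupType.

Lemma open_lcoset (u : T) (A : set T) : open A -> open (lcoset u A).
Proof.
move=> oA.
have -> : lcoset u A = [set v | A (u^-1 * v)].
  apply/seteqP; split=> [_ [a Aa <-] /=|v /= Av]; first by rewrite mulKg.
  by exists (u^-1 * v) => //; rewrite mulVKg.
by move/continuousP: (@mulgl_continuous T u^-1); apply.
Qed.

Lemma closed_lcoset (u : T) (A : set T) : closed A -> closed (lcoset u A).
Proof.
move=> cA.
have -> : lcoset u A = [set v | A (u^-1 * v)].
  apply/seteqP; split=> [_ [a Aa <-] /=|v /= Av]; first by rewrite mulKg.
  by exists (u^-1 * v) => //; rewrite mulVKg.
by apply: preimage_closed => // v _; exact: mulgl_continuous.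
Qed.

Lemma open_mul_set (A B : set T) : open B -> open (mul_set A B).
Proof.
move=> oB; have -> : mul_set A B = \bigcup_(a in A) lcoset a B.
  apply/seteqP; split=> [_ [a Aa [b Bb <-]]|_ [a Aa [b Bb <-]]].
    by exists a => //; exists b.
  by exists a => //; exists b.
by apply: bigcup_open => a _; exact: open_lcoset.
Qed.

Lemma open_subgroup_closed (A : set T) : subgroup A -> open A -> closed A.
Proof.
move=> sA oA; have [A1 AM AV] := sA.
rewrite -openC.
have -> : ~` A = \bigcup_(u in ~` A) lcoset u A.
  apply/seteqP; split=> [u nA|_ [u nA [a Aa <-]] Aua].
    by exists u => //; exists 1 => //; rewrite mulg1.
  apply: nA; rewrite -(mulgK a u); apply: AM => //; exact: AV.
by apply: bigcup_open => u _; exact: open_lcoset.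
Qed.

End OpenSubgroup.

Section Filtration.
Variables (T : topGroupType) (S : nat -> set T).
Hypotheses (cT : compact [set: T]) (hS : filtration_series S).

Lemma filtration_normal n : normal_subgroup (S n).
Proof. by case: hS => _ _ /(_ n)[]. Qed.

Lemma filtration_subgroup n : subgroup (S n).
Proof. by case: (filtration_normal n). Qed.

Lemma filtration1 n : S n 1.
Proof. by case: (filtration_subgroup n). Qed.

Lemma filtration_open n : open (S n).
Proof. by case: hS => _ _ /(_ n)[]. Qed.

Lemma filtration_closed n : closed (S n).
Proof. exact: open_subgroup_closed (filtration_subgroup n) (filtration_open n).
  Qed.

Lemma filtration_le m n : (m <= n)%N -> S n `<=` S m.
Proof.
have [_ Sd _ _] := hS.
move=> mn; rewrite -(subnKC mn); elim: (n - m)%N => [|k IH];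
  first by rewrite addn0.
by rewrite addnS; apply: subset_trans IH.
Qed.

Lemma filtration_basis (U : set T) : open U -> U 1 -> exists n, S n `<=` U.
Proof.
move=> oU U1.
have [_ Sd _ Si] := hS.
have cU : compact (~` U).
  by apply: (subclosed_compact _ cT) => //; exact: open_closedC.
have [n|n|u nU|n An] := @compact_increasing_cover _ _ (fun n => ~` S n) cU.
- exact/closed_openC/filtration_closed.
- exact/subsetC/Sd.
- apply: contrapT => nu; apply: nU; have -> // : u = 1.
  have : (\bigcap_i S i) u.
    by move=> n _; apply: contrapT => nS; apply: nu; exists n.
  by rewrite Si.
- by exists n; rewrite -[U]setCK; apply: subsetCr => u Sn /An.
Qed.

(** The closure of A is the intersection of the A S_n. This reduces membership in a closed set to a
    question in the finite quotients by the S_n. *)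
Lemma closed_filtrationP (A : set T) :
  closed A <-> (forall u, (forall n, mul_set A (S n) u) -> A u).
Proof.
split=> [cA u Au|h].
  apply: contrapT => nAu.
  have [] := @filtration_basis [set v | (~` A) (u * v)].
  - by move/continuousP: (@mulgl_continuous T u); apply; exact: closed_openC.
  - by rewrite /= mulg1.
  move=> n Sn; have [a Aa [s Ss e]] := Au n.
  have /Sn /= : S n s^-1 by case: (filtration_subgroup n) => _ _; apply.
  by rewrite -e mulgK.
move=> u clu; apply: h => n.
have [|a [Aa [s Ss e]]] := clu (lcoset u (S n)).
  apply: open_nbhs_nbhs; split; first exact/open_lcoset/filtration_open.
  by exists 1; [exact: filtration1|rewrite mulg1].
exists a => //; exists s^-1; last by rewrite -e mulgK.
by case: (filtration_subgroup n) => _ _; apply.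
Qed.

Lemma closed_fin_index (K E : set T) : closed K -> fin_index E K ->
  subgroup E -> K `<=` E -> K 1 -> closed E.
Proof.
move=> cK f [_ EM _] KE K1.
have -> : E = \bigcup_(C in cosets E K) C.
  apply/seteqP; split=> [u Eu|_ [_ [v Ev <-] [k Kk <-]]].
    by exists (lcoset u K); [exists u|exists 1; rewrite ?mulg1].
  by apply: EM => //; exact: KE.
by apply: closed_bigcup => // _ [v _ <-]; exact: closed_lcoset.
Qed.

Section ProP.
Variable p : nat.
Hypotheses (hp : prime p)
  (Sp : forall n, exists k, gindex setT (S n) = (p ^ k)%N).

Lemma filtration_fin_index n : fin_index setT (S n).
Proof.
have [k e] := Sp n; apply: fin_index_gindex.
by rewrite e expn_gt0 prime_gt0.
Qed.

(** log_p |K S_n : S_n| as a natural number: [gindexE] shows that the index is a pure power of p, so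
    its p-adic valuation is its logarithm. *)
Definition gdim (K : set T) n := logn p (gindex (mul_set K (S n)) (S n)).

Lemma gindexE (K : set T) n : subgroup K ->
  gindex (mul_set K (S n)) (S n) = (p ^ gdim K n)%N.
Proof.
move=> sK; have [k e] := Sp n.
have sKS := subgroup_mul sK (filtration_normal n).
have h := gindexM (subgroupT T) sKS (filtration_subgroup n)
  (mul_setr (let: And3 K1 _ _ := sK in K1)) (@subsetT _ _)
  (@filtration_fin_index n).
have : (gindex (mul_set K (S n)) (S n) %| p ^ k)%N by rewrite -e h dvdn_mull.
by rewrite /gdim; case/dvdn_pfactor => // m _ ->; rewrite pfactorK.
Qed.

Lemma gindexTE n : gindex setT (S n) = (p ^ gdim setT n)%N.
Proof. by rewrite -gindexE// mul_setTl//; exact: filtration1. Qed.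

(** Lagrange in the quotient by S_n: the order d of u modulo S_n is the index of S_n in its
    extension by u, hence divides |T : S_n|. Such a d exists because the powers of u meet only
    finitely many cosets. *)
Lemma filtration_exp n (u : T) : S n (u ^+ (p ^ gdim setT n)).
Proof.
have sS := filtration_subgroup n; have [S1 SM SV] := sS.
have [d [d0 Sd dmin]] : exists d, [/\ (0 < d)%N, S n (u ^+ d) &
    forall a, (0 < a < d)%N -> ~ S n (u ^+ a)].
  have ex : exists d, (0 < d)%N && `[< S n (u ^+ d) >].
    apply: contrapT => nd.
    pose f a := lcoset (u ^+ a) (S n).
    have fi : injective f.
      suff H a b : (a < b)%N -> f a <> f b.
        by move=> a b ab; have [/H|/H/nesym|] := ltngtP a b.
      move=> ab /(lcosetP _ _ sS) h; apply: nd; exists (b - a)%N.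
      rewrite subn_gt0 ab /=; apply/asboolP; move: h.
      by rewrite -{1}(subnKC (ltnW ab)) expgnDr mulKg.
    apply: infinite_nat.
    rewrite -(eq_finite_set (inj_card_eq (f := f) (A := setT) _)); last first.
      by move=> a b _ _; exact: fi.
    apply: sub_finite_set (@filtration_fin_index n).
    by move=> _ [a _ <-]; exists (u ^+ a).
  case: (ex_minnP ex) => d /andP[d0 /asboolP Sd] dmin; exists d; split=> //.
  move=> a /andP[a0 ad] Sa; have := dmin a; rewrite a0 /= leqNgt ad.
  by move=> /(_ (asboolT Sa)).
have SJ v : S n v -> S n (v ^ u) by case: (filtration_normal n) => _; apply.
have sC := cyc_ext_subgroup sS SJ d0 Sd.
have := gindexM (subgroupT T) sC sS (@cyc_ext_sub _ _ _) (@subsetT _ _)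
  (@filtration_fin_index n).
rewrite (gindex_cyc_ext sS d0 Sd dmin) gindexTE => ->.
by rewrite mulnC expgnA; exact: subgroupX.
Qed.

End ProP.
End Filtration.

(** * Closed central subgroups of prescribed dimension *)

Section Prescribed.
Variables (T : topGroupType) (S : nat -> set T) (p : nat).
Hypotheses (hS : filtration_series S) (hp : prime p)
  (Sp : forall n, exists k, gindex setT (S n) = (p ^ k)%N).
Variable Z : set T.
Hypotheses (sZ : subgroup Z) (ZC : forall u v, Z u -> commute u v)
  (Zp : forall u, Z u -> u ^+ p = 1).

Lemma central_conj u v : Z u -> u ^ v = u.
Proof. by move=> Zu; rewrite conjgE (ZC v Zu) mulKg. Qed.

Lemma central_normal K : subgroup K -> K `<=` Z -> normal_subgroup K.
Proof. by move=> sK KZ; split=> // u v Ku; rewrite central_conj//;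
  exact: KZ. Qed.

(** The finite stages of the subgroup to be built: as L meets S_n trivially, the order p^k of L is
    also |L S_n : S_n|. *)
Definition transversal_part n k (L : set T) :=
  [/\ subgroup L, L `<=` Z, L `&` S n `<=` [set 1] &
      gindex L [set 1] = (p ^ k)%N].

Lemma transversal_part_gindex n k L : transversal_part n k L ->
  gindex L (S n) = (p ^ k)%N.
Proof.
move=> [sL LZ LS e]; rewrite gindex_trivI//; first exact: filtration_subgroup.
by apply: fin_index_gindex; rewrite e expn_gt0 prime_gt0.
Qed.

Lemma transversal_part_cyc_ext n k L e : transversal_part n k L ->
  Z e -> ~ mul_set L (S n) e -> transversal_part n k.+1 (cyc_ext L e).
Proof.
move=> [sL LZ LS eL] Ze nLSe; have [L1 LM LV] := sL.
have sLS := subgroup_mul sL (filtration_normal hS n).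
have LJ u : L u -> L (u ^ e) by move=> Lu; rewrite central_conj//; exact: LZ.
have ep (M : set T) : subgroup M -> M (e ^+ p) by move=> [M1 _ _]; rewrite Zp.
(* Since e^p = 1, a power e^a in L S_n with a prime to p would put e = e^gcd(a, p) itself in L S_n.
   This gives both the trivial intersection with S_n and the order of the extension. *)
have nLS a : (0 < a)%N -> coprime a p -> ~ mul_set L (S n) (e ^+ a).
  move=> a0 /eqP cap h; apply: nLSe.
  by have := subgroup_gcd_exp sLS a0 h (ep _ sLS); rewrite cap.
have LLS : L `<=` mul_set L (S n) by apply: mul_setl; exact: filtration1.
have p0 := prime_gt0 hp.
have sC : subgroup (cyc_ext L e) by exact: (cyc_ext_subgroup sL LJ p0 (ep _
  sL)).
have fC : fin_index (cyc_ext L e) L by exact: (fin_index_cyc_ext sL p0 (ep _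
  sL)).
split=> //.
- exact: cyc_ext_min.
- move=> _ [[a _ [l Ll <-]] Sal].
  have [pa|npa] := boolP (p %| a)%N.
    have ea : e ^+ a = 1.
      by case/dvdnP: pa => b ->; rewrite mulnC expgnA Zp// expg1n.
    by move: Sal; rewrite ea mul1g => Sl; exact: LS.
  case: (nLS a); first by case: a npa {Sal} => //; rewrite dvdn0.
    by rewrite coprime_sym prime_coprime.
  have -> : e ^+ a = l^-1 * (e ^+ a * l).
    by rewrite -(commuteX a (ZC e (LZ _ Ll))) mulKg.
  by exists l^-1; [exact: LV|exists (e ^+ a * l)].
- rewrite (gindexM sC sL (@subgroup1 T))//.
  + rewrite eL (gindex_cyc_ext sL p0 (ep _ sL)) ?expnS// => a /andP[a0 ap] La.
    apply: (nLS a a0); last exact: LLS.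
    by rewrite coprime_sym prime_coprime// gtnNdvd.
  + by move=> _ ->.
  + exact: cyc_ext_sub.
  + apply: (fin_indexM sC sL (@subgroup1 T)) => //; first by move=> _ ->.
      exact: cyc_ext_sub.
    by apply: fin_index_gindex; rewrite eL expn_gt0 p0.
Qed.

Let z n := gdim S p Z n.

Lemma central_fin_index n : fin_index Z (Z `&` S n).
Proof.
apply: fin_index_setI => //; first exact: filtration_subgroup.
exact: fin_indexS (filtration_fin_index hp Sp n).
Qed.

Lemma gdim_central n : gindex Z (Z `&` S n) = (p ^ z n)%N.
Proof.
have sS := filtration_subgroup hS n.
rewrite -(gindexE hS hp Sp)// gindex_mul// -gindex_setI//.
exact: central_fin_index.
Qed.

Lemma gdim_central_le n : (z n <= z n.+1)%N.
Proof.
have sS m := filtration_subgroup hS m.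
have := gindexM sZ (subgroupI sZ (sS n)) (subgroupI sZ (sS n.+1)).
rewrite !gdim_central => h.
have {}h : (p ^ z n %| p ^ z n.+1)%N.
  apply/dvdnP; exists (gindex (Z `&` S n) (Z `&` S n.+1)); rewrite mulnC;
    apply: h.
  - by apply: setIS; exact: (filtration_le hS).
  - exact: subIsetl.
  - exact: central_fin_index.
by rewrite dvdn_Pexp2l ?prime_gt1// in h.
Qed.

Lemma gdim_central_step n :
  gindex (Z `&` S n) (Z `&` S n.+1) = (p ^ (z n.+1 - z n))%N.
Proof.
have sS m := filtration_subgroup hS m.
apply/eqP; rewrite -(eqn_pmul2l (m := p ^ z n)) ?expn_gt0 ?prime_gt0//.
rewrite -expnD subnKC ?gdim_central_le// -!gdim_central -gindexM//.
- by apply: subgroupI.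
- by apply: subgroupI.
- by apply: setIS; exact: (filtration_le hS).
- exact: central_fin_index.
Qed.

(** The j new generators are taken one at a time from Z ∩ S_n and outside M S_(n+1). Being in S_n,
    they leave the image modulo S_n unchanged, so earlier stages are not disturbed. *)
Lemma transversal_part_extend n k L j : transversal_part n k L ->
  (j <= z n.+1 - z n)%N ->
  exists M, [/\ transversal_part n.+1 (k + j) M, L `<=` M &
    M `<=` mul_set L (S n)].
Proof.
move=> LT; have [sL LZ LS eL] := LT.
have sS m := filtration_subgroup hS m; have nS m := filtration_normal hS m.
have sLS := subgroup_mul sL (nS n).
elim: j => [_|j IH jz].
  exists L; split=> //; last by apply: mul_setl; exact: filtration1.
  rewrite addn0; split=> // u [Lu Su]; apply: LS; split=> //.
  exact: (filtration_le hS (leqnSn n)).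
have [M [MT LM MLS]] := IH (ltnW jz); have [sM MZ MS eM] := MT.
have [e [[Ze Se] nMe]] :
    exists e, (Z `&` S n) e /\ ~ mul_set M (S n.+1) e.
  apply: contrapT => ne.
  have ZM : Z `&` S n `<=` mul_set M (S n.+1).
    by move=> e Ze; apply: contrapT => nMe; apply: ne; exists e.
  pose Zn := Z `&` S n; pose Zn1 := Z `&` S n.+1.
  have nZ m : normal_subgroup (Z `&` S m).
    by apply: normal_subgroupI; [exact: central_normal|exact: nS].
  have sZn m : subgroup (Z `&` S m) by case: (nZ m).
  have Zn11 m : (Z `&` S m) 1 by case: (sZn m).
  have ZZ : Zn1 `<=` Zn by apply: setIS; exact: (filtration_le hS).
  have LZn_fin : fin_index Z Zn1 by exact: central_fin_index.
  have LZ_Z m : mul_set L (Z `&` S m) `<=` Z by apply: mul_set_min => //;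
    exact: subIsetl.
  have MZ_Z m : mul_set M (Z `&` S m) `<=` Z by apply: mul_set_min => //;
    exact: subIsetl.
  have gI (A : set T) a m : subgroup A -> A `<=` Z -> transversal_part m a A ->
      gindex (mul_set A (Z `&` S m)) (Z `&` S m) = (p ^ a)%N.
    move=> sA AZ [_ _ AS eA]; rewrite gindex_mul// gindex_trivI//.
      by move=> u [Au [_ Su]]; exact: AS.
    by apply: fin_index_gindex; rewrite eA expn_gt0 prime_gt0.
  (* If Z ∩ S_n were contained in M S_(n+1), then L (Z ∩ S_n) would lie in M (Z ∩ S_(n+1)). Counting
     both modulo Z ∩ S_(n+1) contradicts j < z(n+1) - z(n). *)
  have : (p ^ (k + (z n.+1 - z n)) <= p ^ (k + j))%N.
    rewrite -(gI _ _ _ sM MZ MT) expnD -(gI _ _ _ sL LZ LT) -gdim_central_step.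
    rewrite -gindexM//.
    - apply: gindexS; last exact: fin_indexS LZn_fin.
      apply: mul_set_min.
      + exact: subgroup_mul.
      + by apply: subset_trans LM _; exact: mul_setl.
      + move=> u [Zu Su]; have [m Mm [s Ss e]] := ZM _ (conj Zu Su).
        exists m => //; exists s => //; split=> //.
        have -> : s = m^-1 * u by rewrite -e mulKg.
        by case: (sZ) => _ ZM' ZV; apply: ZM' => //; apply/ZV/MZ.
    - exact: subgroup_mul.
    - by apply: mul_setr; case: sL.
    - by apply: fin_indexS LZn_fin.
  rewrite leq_exp2l ?prime_gt1// leq_add2l => zj.
  by have := leq_trans jz zj; rewrite ltnn.
have MT' := transversal_part_cyc_ext MT Ze nMe.
exists (cyc_ext M e); split.
- by rewrite addnS.
- exact: subset_trans (@cyc_ext_sub _ _ _).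
- apply: cyc_ext_min => //; apply: mul_setr => //.
  by case: sL.
Qed.

Lemma prescribed_central_subgroup (t : nat -> nat) : closed Z ->
  t 0%N = 0%N -> (forall n, (t n <= t n.+1)%N) ->
  (forall n, (t n.+1 - t n <= z n.+1 - z n)%N) ->
  exists K, [/\ closed K, normal_subgroup K, K `<=` Z &
    forall n, gdim S p K n = t n].
Proof.
move=> cZ t0 tS tz.
have sS m := filtration_subgroup hS m; have nS m := filtration_normal hS m.
have [|next nextP] := @boolp.choice (nat * set T) (set T) (fun nL M =>
    transversal_part nL.1 (t nL.1) nL.2 ->
    [/\ transversal_part nL.1.+1 (t nL.1.+1) M, nL.2 `<=` M &
        M `<=` mul_set nL.2 (S nL.1)]).
  move=> -[n L] /=.
  (* Choice asks for a value at every pair, so [set0] is returned where L is not a valid stage. *)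
  have [LT|nLT] := pselect (transversal_part n (t n) L); last by exists set0.
  have [M] := transversal_part_extend LT (tz n).
  by rewrite subnKC//; exists M.
pose L := fix L n := if n is m.+1 then next (m, L m) else [set (1 : T)].
have LT n : transversal_part n (t n) (L n).
  elim: n => [|n IH]; last by have [] := nextP (n, L n) IH.
  rewrite t0 /=; split;
    [exact: subgroup1| |by move=> u []|exact/gindex_id/subgroup1].
  by move=> _ ->; case: sZ.
have LSn n : L n `<=` L n.+1 by have [] := nextP (n, L n) (LT n).
have LSd n : L n.+1 `<=` mul_set (L n) (S n) by have [] := nextP (n,
  L n) (LT n).
have sL n : subgroup (L n) by case: (LT n).
have sLS n : subgroup (mul_set (L n) (S n)) by exact: subgroup_mul.
have Lmono m n : (m <= n)%N -> L m `<=` L n.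
  move=> mn; rewrite -(subnKC mn); elim: (n - m)%N => [|k IH];
    first by rewrite addn0.
  by rewrite addnS; apply: subset_trans (LSn _).
have Ltail m n : L m `<=` mul_set (L n) (S n).
  have [/Lmono mn|/ltnW nm] := leqP m n.
    by apply: subset_trans mn _; apply: mul_setl; case: (sS n).
  rewrite -(subnKC nm); elim: (m - n)%N => [|k IH].
    by rewrite addn0; apply: mul_setl; case: (sS n).
  rewrite addnS; apply: subset_trans (LSd _) _; apply: mul_set_min => //.
  apply: subset_trans (filtration_le hS (leq_addr k n)) _.
  by apply: mul_setr; case: (sL n).
(* In the role of the closure of the union of the L_n. As an intersection of Z with the open
   subgroups L_n S_n it is visibly closed, and K S_n = L_n S_n because L_n lies in K. *)
pose K := Z `&` \bigcap_n mul_set (L n) (S n).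
have LK n : L n `<=` K.
  move=> u Lu; split; first by case: (LT n) => _ + _ _; apply.
  by move=> m _; exact: Ltail Lu.
have sK : subgroup K.
  apply: subgroupI => //; split.
  - by move=> n _; case: (sLS n).
  - by move=> u v Ku Kv n _; case: (sLS n) => _ M _; apply: M;
    [exact: Ku|exact: Kv].
  - by move=> u Ku n _; case: (sLS n) => _ _; apply; exact: Ku.
have KZ : K `<=` Z by move=> u [].
exists K; split=> //.
- apply: closedI => //; apply: closed_bigI => n _.
  apply: open_subgroup_closed => //; exact/open_mul_set/(filtration_open hS).
- exact: central_normal.
- move=> n.
  have e : mul_set K (S n) = mul_set (L n) (S n).
    apply/seteqP; split; last exact/mul_setS/LK.
    apply: mul_set_min => //; first by move=> u [_ h]; exact: h.
    by apply: mul_setr; case: (sL n).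
  rewrite /gdim e gindex_mul// (transversal_part_gindex (LT n)).
  by rewrite pfactorK.
Qed.

End Prescribed.

(** * The lower limit *)

Local Open Scope ring_scope.

Section LimInf.
Variable R : realType.
Implicit Types (u v : R^nat) (l b c : R).

Definition unit_bounded u := forall n, 0 <= u n <= 1.

Lemma unit_bounded_fun u : unit_bounded u -> bounded_fun u.
Proof.
move=> ub; exists 1; split=> // x x1 n _ /=.
by have /andP[? ?] := ub n; rewrite ger0_norm//; apply: le_trans (ltW x1).
Qed.

Lemma le_limn_inf_near u l : unit_bounded u ->
  (exists n, forall m, (n <= m)%N -> l <= u m) -> l <= limn_inf u.
Proof.
move=> ub [n un]; rewrite limn_infE; last exact: unit_bounded_fun.
apply: (@le_trans _ _ (infs u n)).
  apply: lb_le_inf; first by exists (u n); exists n => /=.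
  by move=> _ [m /= nm <-]; exact: un.
apply: ub_le_sup; last by exists n.
exact/bounded_fun_has_ubound_infs/unit_bounded_fun.
Qed.

Lemma limn_inf_near u e : unit_bounded u -> 0 < e ->
  exists n, forall m, (n <= m)%N -> limn_inf u - e <= u m.
Proof.
move=> ub e0; rewrite limn_infE; last exact: unit_bounded_fun.
have [|_ [n _ <-] h] := @sup_adherent _ (range (infs u)) _ e0.
  split; first by exists (infs u 0); exists 0%N.
  exact/bounded_fun_has_ubound_infs/unit_bounded_fun.
exists n => m nm; apply: (le_trans (ltW h)).
apply: ge_inf; last by exists m.
by exists 0 => _ [k _ <-]; have /andP[] := ub k.
Qed.

Lemma limn_inf_ge0 u : unit_bounded u -> 0 <= limn_inf u.
Proof.
move=> ub; apply: le_limn_inf_near => //; exists 0%N => m _.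
by have /andP[] := ub m.
Qed.

Lemma le_limn_inf u v : unit_bounded u -> unit_bounded v ->
  (forall n, u n <= v n) -> limn_inf u <= limn_inf v.
Proof.
move=> ub vb uv; apply/ler_addgt0Pr => e e0; rewrite -lerBlDr.
apply: le_limn_inf_near => //; have [n h] := limn_inf_near ub e0.
by exists n => m nm; apply: le_trans (h m nm) (uv m).
Qed.

Lemma limn_inf_scale_near u v b : unit_bounded u -> unit_bounded v -> 0 <= b ->
  (forall e, 0 < e -> exists n, forall m, (n <= m)%N ->
    `|u m - b * v m| <= e) ->
  limn_inf u = b * limn_inf v.
Proof.
move=> ub vb b0 h; apply/eqP; rewrite eq_le; apply/andP; split.
  apply/ler_addgt0Pr => e e0.
  have e2 : 0 < e / 2 by rewrite divr_gt0.
  have [n1 h1] := h _ e2; have [n2 h2] := limn_inf_near ub e2.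
  have h3 m : (maxn n1 n2 <= m)%N -> limn_inf u - e <= b * v m.
    rewrite geq_max => /andP[/h1 + /h2].
    by rewrite ler_norml => /andP[]; lra.
  have [b00|bn0] := eqVneq b 0.
    by have := h3 _ (leqnn _); rewrite b00 !mul0r; lra.
  have bp : 0 < b by rewrite lt_neqAle eq_sym bn0.
  suff : (limn_inf u - e) / b <= limn_inf v.
    by rewrite ler_pdivrMr// mulrC; lra.
  apply: le_limn_inf_near => //; exists (maxn n1 n2) => m /h3.
  by rewrite ler_pdivrMr// mulrC.
apply/ler_addgt0Pr => e e0.
have e2 : 0 < e / 2 by rewrite divr_gt0.
(* The denominator b + 1 instead of b keeps the case b = 0 inside the same estimate. *)
have e3 : 0 < e / 2 / (b + 1) by rewrite divr_gt0// ltr_wpDl.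
have [n1 h1] := h _ e2; have [n2 h2] := limn_inf_near vb e3.
rewrite -lerBlDr; apply: le_limn_inf_near => //.
exists (maxn n1 n2) => m; rewrite geq_max => /andP[/h1 + /h2 k].
rewrite ler_norml => /andP[+ _].
have k2 : b * (e / 2 / (b + 1)) <= e / 2.
  rewrite mulrCA ger_pMr// ler_pdivrMr ?mul1r; last by rewrite ltr_wpDl.
  lra.
have := ler_wpM2l b0 k; rewrite mulrBr; lra.
Qed.

(** The numerators differ by at most c, so the quotients differ by at most c / g(n), which tends to
    0. *)
Lemma limn_inf_quotient (a v g : nat -> nat) b c :
  (forall n, (a n <= g n)%N) -> (forall n, (v n <= g n)%N) -> 0 <= b ->
  (forall k, exists n, forall m, (n <= m)%N -> (k <= g m)%N) ->
  (forall n, `|(a n)%:R - b * (v n)%:R| <= c) ->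
  limn_inf (fun n => (a n)%:R / (g n)%:R) =
  b * limn_inf (fun n => (v n)%:R / (g n)%:R) :> R.
Proof.
move=> ag vg b0 goo h.
have ubd (w : nat -> nat) : (forall n, (w n <= g n)%N) ->
    unit_bounded (fun n => (w n)%:R / (g n)%:R).
  move=> wg n; have [g0|g0] := posnP (g n);
    first by rewrite g0 invr0 mulr0 lexx ler01.
  by rewrite divr_ge0//= ler_pdivrMr ?ltr0n// mul1r ler_nat.
apply: limn_inf_scale_near; [exact: ubd|exact: ubd|exact: b0|].
(* Beyond this threshold c / g(m) <= e; the successor ensures that g(m) is positive. *)
move=> e e0; have [n hn] := goo (Num.bound (c / e)).+1.
exists n => m /hn hm.
have gm : 0 < (g m)%:R :> R by rewrite ltr0n; apply: leq_trans hm.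
rewrite mulrA -mulrBl normrM normfV (ger0_norm (ltW gm)).
rewrite ler_pdivrMr//; apply: (le_trans (h m)).
rewrite -ler_pdivrMl// mulrC.
have c0 : 0 <= c by apply: le_trans (h 0%N).
apply: (le_trans (ltW (archi_boundP _))); first by rewrite divr_ge0// ltW.
by rewrite ler_nat; apply: leq_trans hm.
Qed.

End LimInf.

(** * The base group of the wreath product *)

Section WreathBase.
Variables (A : zmodType) (C : finZmodType).

Definition wr_baseg (f : {ffun C -> A}) : wreath A C := (0, f).

Lemma wr_basegD f g : wr_baseg (f + g) = (wr_baseg f * wr_baseg g)%g.
Proof.
congr pair; first by rewrite /= addr0.
by apply/ffunP => d; rewrite !ffunE /= subr0.
Qed.

Lemma wr_baseg0 : wr_baseg 0 = 1%g.
Proof. by []. Qed.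

Lemma wr_basegN f : wr_baseg (- f) = ((wr_baseg f)^-1)%g.
Proof. by apply/esym/mulg1_eq; rewrite -wr_basegD subrr. Qed.

Lemma wr_basegMn f n : wr_baseg (f *+ n) = (wr_baseg f ^+ n)%g.
Proof.
elim: n => [|n IH]; first by [].
by rewrite mulrS wr_basegD IH expgS.
Qed.

Lemma wr_basegJ f (u : wreath A C) :
  (wr_baseg f ^ u)%g = wr_baseg [ffun d => f (d - u.1)].
Proof.
apply: (@mulgI _ u); rewrite -conjgC; case: u => c g.
congr pair; first by rewrite /= add0r addr0.
by apply/ffunP => d; rewrite !ffunE /= subr0 addrC.
Qed.

End WreathBase.

(** * The base group of C_p wr C_(p^k) through polynomials *)

Section CyclicBase.
Variable p : nat.
Hypothesis hp : prime p.

Lemma cyc_card k : (p ^ k).-1.+1 = (p ^ k)%N.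
Proof. by rewrite prednK// expn_gt0 prime_gt0. Qed.

Lemma cyc_inZp_mulrn k n : (inZp 1 : cyc p k) *+ n = inZp n.
Proof.
elim: n => [|n IH]; first by apply/val_inj; rewrite /= mod0n.
by rewrite mulrS IH; apply/val_inj; rewrite /= modnDm.
Qed.

Lemma cyc_inZp_eq0 k n : (inZp n = 0 :> cyc p k) <-> (p ^ k %| n)%N.
Proof.
split=> [/(congr1 val) /=|/eqP h]; first by rewrite /dvdn cyc_card => ->.
by apply/val_inj; rewrite /= cyc_card.
Qed.

(* The base group of C_p wr C_(p^k) is F_p[X]/(X^(p^k) - 1), where 'X acts as
   conjugation by the generator of the top group; psi k is the projection. *)
Definition psi k (P : {poly 'F_p}) : {ffun cyc p k -> 'F_p} :=
  [ffun d => \sum_(i < size P) P`_i *+ (inZp i == d)].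

Lemma psiE k n (P : {poly 'F_p}) d : (size P <= n)%N ->
  psi k P d = \sum_(i < n) P`_i *+ (inZp i == d).
Proof.
move=> sn; rewrite ffunE.
rewrite (big_ord_widen n (fun i => P`_i *+ (inZp i == d)) sn) big_mkcond.
apply: eq_bigr => i _; case: ltnP => // h.
by rewrite nth_default// mul0rn.
Qed.

Lemma psi0 k : psi k 0 = 0.
Proof. by apply/ffunP => d; rewrite !ffunE size_poly0 big_ord0. Qed.

Lemma psiD k (P Q : {poly 'F_p}) : psi k (P + Q) = psi k P + psi k Q.
Proof.
apply/ffunP => d; rewrite [RHS]ffunE.
pose n := maxn (size P) (size Q).
rewrite !(@psiE k n) ?leq_maxl ?leq_maxr//; last exact: size_polyD.
by rewrite -big_split /=; apply: eq_bigr => i _; rewrite coefD mulrnDl.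
Qed.

Lemma psiN k (P : {poly 'F_p}) : psi k (- P) = - psi k P.
Proof.
by apply/eqP; rewrite -addr_eq0 -psiD addNr psi0.
Qed.

Lemma psi_mulX k (P : {poly 'F_p}) :
  psi k (P * 'X) = [ffun d => psi k P (d - inZp 1)].
Proof.
apply/ffunP => d; rewrite [RHS]ffunE [LHS](@psiE k (size P).+1); last first.
  by apply: (leq_trans (size_polyMleq _ _)); rewrite size_polyX addn2.
rewrite big_ord_recl coefMX /= mul0rn add0r ffunE.
apply: eq_bigr => i _; rewrite coefMX /= [RHS]/GRing.natmul.
congr (_ *+ _); congr nat_of_bool.
rewrite [RHS]eq_sym subr_eq [RHS]eq_sym; congr (_ == d).
by apply/val_inj; rewrite /= /bump modnDm addnC.
Qed.

Lemma psi_mulXn k n (P : {poly 'F_p}) :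
  psi k (P * 'X^n) = [ffun d => psi k P (d - inZp n)].
Proof.
elim: n => [|n IH].
  rewrite expr0 mulr1; apply/ffunP => d; rewrite [RHS]ffunE.
  by rewrite (_ : inZp 0 = 0 :> cyc p k) ?subr0//; exact: (cyc_inZp_eq0 k 0).2.
rewrite exprSr mulrA psi_mulX IH; apply/ffunP => d;
  rewrite [LHS]ffunE [X in X = _]ffunE [RHS]ffunE.
by rewrite -addrA -opprD -[inZp n]cyc_inZp_mulrn -mulrS cyc_inZp_mulrn.
Qed.

Lemma psi_subX k (P : {poly 'F_p}) : psi k (P * ('X^(p ^ k) - 1)) = 0.
Proof.
rewrite mulrBr mulr1 psiD psiN psi_mulXn; apply/eqP; rewrite subr_eq0.
apply/eqP/ffunP => d; rewrite [LHS]ffunE.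
by rewrite (_ : inZp (p ^ k) = 0 :> cyc p k) ?subr0//;
  exact: (cyc_inZp_eq0 k _).2.
Qed.

Lemma psiZ k (c : 'F_p) (P : {poly 'F_p}) : psi k (c *: P) = psi k P *+ c.
Proof.
have -> : c *: P = P *+ c by rewrite -{1}(natr_Zp c) scaler_nat.
elim: (c : nat) => [|n IH]; last by rewrite !mulrS psiD IH.
by rewrite !mulr0n psi0.
Qed.

Lemma psi_surj k (f : {ffun cyc p k -> 'F_p}) : exists P, psi k P = f.
Proof.
exists (\poly_(i < (p ^ k).-1.+1) f (inord i)); apply/ffunP => d.
rewrite (psiE _ (size_poly _ _)) (bigD1 d)//= big1 ?addr0.
  by rewrite coef_poly ltn_ord inord_val (_ : inZp d == d) ?mulr1n// valZpK.
move=> i id; rewrite (_ : (inZp i == d) = false) ?mulr0n//.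
by rewrite valZpK; apply/negbTE.
Qed.

(** Adding up along the fibres of the reduction of residues only regroups the coefficients of P.
    Hence one polynomial representing an element at some level represents it at all lower levels. *)
Lemma psi_red k (P : {poly 'F_p}) :
  [ffun e => \sum_(d | @cyc_red p k d == e) psi k.+1 P d] = psi k P.
Proof.
apply/ffunP => e; rewrite !ffunE.
under eq_bigr do rewrite ffunE.
rewrite exchange_big /=; apply: eq_bigr => i _.
rewrite big_mkcond (bigD1 (inZp i))//= big1 ?addr0.
  rewrite eqxx mulr1n (_ : cyc_red _ = inZp i); first by case: eqP.
  by apply/val_inj; rewrite /= modn_dvdm// cyc_dvd.
by move=> d; rewrite eq_sym => /negbTE->; rewrite mulr0n if_same.
Qed.

Lemma subX1_expn k : ('X - 1%:P) ^+ (p ^ k) = 'X^(p ^ k) - 1 :> {poly 'F_p}.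
Proof.
have ch : p \in [pchar {poly 'F_p}] by rewrite pchar_poly pchar_Fp.
rewrite exprDn_pchar;
  last by rewrite pnatX (eq_pnat _ (pchar_poly _)) pnatE// pchar_Fp.
rewrite exprNn_pchar;
  last by rewrite pnatX (eq_pnat _ (pchar_poly _)) pnatE// pchar_Fp.
by rewrite expr1n.
Qed.

(* gcd(P, (X - 1)^(p^m)) is a power (X - 1)^j, and j < p^k as (X - 1)^(p^k) does
   not divide P *)
Lemma subX_Bezout k m (P : {poly 'F_p}) : ~~ ('X^(p ^ k) - 1 %| P) ->
  exists U V, 'X^(p ^ k) - 1 = U * P + V * ('X^(p ^ m) - 1).
Proof.
rewrite -!subX1_expn => nP.
have /dvdp_exp_XsubCP[j jm ej] := dvdp_gcdr P (('X - 1%:P) ^+ (p ^ m)).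
have jk : (j < p ^ k)%N.
  rewrite ltnNge; apply/negP => kj; case/negP: nP.
  apply: (@dvdp_trans _ (('X - 1%:P) ^+ j)); first exact: dvdp_exp2l.
  by rewrite -(eqp_dvdl _ ej) dvdp_gcdl.
have [[u v] /= e] := Bezoutp P (('X - 1%:P) ^+ (p ^ m)).
have : u * P + v * ('X - 1%:P) ^+ (p ^ m) %| ('X - 1%:P) ^+ (p ^ k).
  rewrite (eqp_dvdl _ e) (eqp_dvdl _ ej).
  by apply: dvdp_exp2l; exact: ltnW.
rewrite dvdp_eq => /eqP h; set Q := _ %/ _ in h.
by exists (Q * u), (Q * v); rewrite h mulrDr !mulrA.
Qed.

Section Ideal.
Variables (m : nat) (I : set (cyc_wreath p m)).
Hypotheses (sI : subgroup I)
  (IJ : forall u, I u -> I (u ^ wr_top 'F_p (inZp 1 : cyc p m))%g).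

(** Stability under conjugation by the top generator is stability under multiplication by X, and
    scalars of F_p are natural multiples, so Horner's scheme for Q gives an ideal. *)
Lemma psi_ideal (P Q : {poly 'F_p}) :
  I (wr_baseg (psi m P)) -> I (wr_baseg (psi m (Q * P))).
Proof.
have [I1 IM IV] := sI; move=> IP.
elim/poly_ind: Q => [|Q c IH].
  by rewrite mul0r psi0.
rewrite mulrDl mulrAC mul_polyC psiD wr_basegD; apply: IM.
  by have := IJ IH; rewrite wr_basegJ -psi_mulX.
by rewrite psiZ wr_basegMn; exact: subgroupX.
Qed.

(** Nonvanishing at level k means that X^(p^k) - 1 does not divide P. In the Bezout relation the
    multiple of X^(p^m) - 1 dies at level m, and k does not depend on m. *)
Lemma psi_ideal_subX k (P : {poly 'F_p}) : I (wr_baseg (psi m P)) ->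
  psi k P != 0 -> I (wr_baseg (psi m ('X^(p ^ k) - 1))).
Proof.
move=> IP nP.
have [|U [V ->]] := @subX_Bezout k m P.
  by apply: contra nP => /dvdpP[Q ->]; rewrite psi_subX.
by rewrite psiD psi_subX addr0; exact: psi_ideal.
Qed.

End Ideal.
End CyclicBase.

Local Open Scope group_scope.

(** The elements of s commute and have exponent d modulo K, so adjoining them one by one by
    [cyc_ext] gives finite steps. The last clause makes L the subgroup generated by K and s; it lets
    inclusions and stability under conjugation be checked on K and s alone. *)
Lemma fin_index_extend (T : groupType) d (K : set T) (s : seq T) :
  (0 < d)%N -> subgroup K ->
  (forall e, e \in s -> forall u, K u -> K (u ^ e)) ->
  (forall e, e \in s -> K (e ^+ d)) ->
  (forall e f, e \in s -> f \in s -> K [~ e, f]) ->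
  exists L, [/\ subgroup L, K `<=` L, (forall e, e \in s -> L e),
    fin_index L K & forall M : set T, subgroup M -> K `<=` M ->
      (forall e, e \in s -> M e) -> L `<=` M].
Proof.
move=> d0 sK; have [K1 KM KV] := sK.
elim: s => [|e s IH] KJ Kd KR.
  by exists K; split=> //; rewrite /fin_index cosets_id//; exact: finite_set1.
have es : e \in e :: s by rewrite mem_head.
have ss f : f \in s -> f \in e :: s by rewrite in_cons orbC => ->.
have [f hf|f hf|f g hf hg|L [sL KL sub f Lmin]] := IH.
- exact/KJ/ss.
- exact/Kd/ss.
- by apply: KR; exact: ss.
have [L1 LM LV] := sL.
(* Minimality of L is applied to the preimage of L under conjugation by e: a^e = a [a, e] with
   [a, e] in K. *)
have LJ u : L u -> L (u ^ e).
  apply: (Lmin [set u | L (u ^ e)]); first split=> /=.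
  - by rewrite conj1g.
  - by move=> a b La Lb; rewrite conjMg; exact: LM.
  - by move=> a La; rewrite conjVg; exact: LV.
  - by move=> a Ka; apply: KL; exact: KJ.
  - move=> a sa /=; rewrite (_ : a ^ e = a * [~ a, e]).
      by apply: LM; [exact: sub|apply: KL; apply: KR => //; exact: ss].
    by rewrite commgEl mulVKg.
have Led : L (e ^+ d) by apply: KL; exact: Kd.
exists (cyc_ext L e); split.
- exact: (cyc_ext_subgroup sL LJ d0 Led).
- exact: subset_trans (@cyc_ext_sub _ _ _).
- move=> a; rewrite in_cons => /orP[/eqP->|sa]; first exact: cyc_ext_gen.
  by apply: cyc_ext_sub; exact: sub.
- apply: (fin_indexM _ sL sK) => //.
  + exact: (cyc_ext_subgroup sL LJ d0 Led).
  + exact: cyc_ext_sub.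
  + exact: (fin_index_cyc_ext sL d0 Led).
- move=> M sM KM' sub'; apply: cyc_ext_min => //.
    by apply: Lmin => // a sa; apply: sub'; exact: ss.
  exact: sub'.
Qed.

(** * Coordinates in the inverse limit W *)

Section ProWreathBase.
Variables (p : nat) (hp : prime p).
Implicit Types u v w : pro_wreath p.

Definition pw_top w k : cyc p k := (pw_val w k).1.

Lemma pw_topM u v k : pw_top (u * v) k = (pw_top u k + pw_top v k)%R.
Proof. by []. Qed.

Lemma pw_topV u k : pw_top u^-1 k = (- pw_top u k)%R.
Proof. by []. Qed.

Lemma pw_top1 k : pw_top 1 k = 0%R.
Proof. by []. Qed.

Lemma pw_topJ u v k : pw_top (u ^ v) k = pw_top u k.
Proof. by rewrite conjgE !pw_topM pw_topV addrCA addNr addr0. Qed.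

Lemma pw_topX u k n : pw_top (u ^+ n) k = (pw_top u k *+ n)%R.
Proof.
elim: n => [|n IH]; first by rewrite expg0 pw_top1.
by rewrite expgS pw_topM IH mulrS.
Qed.

Lemma pw_top_x k : pw_top (pw_x p) k = inZp 1.
Proof. by []. Qed.

Lemma pw_topXx k n : pw_top (pw_x p ^+ n) k = inZp n.
Proof. by rewrite pw_topX pw_top_x cyc_inZp_mulrn. Qed.

Lemma pw_valM u v k : pw_val (u * v) k =
  (pw_val u k : cyc_wreath p k) * pw_val v k.
Proof. by []. Qed.

Lemma pw_valV u k : pw_val u^-1 k = (pw_val u k : cyc_wreath p k)^-1.
Proof. by []. Qed.

Lemma pw_valJ u v k : pw_val (u ^ v) k =
  (pw_val u k : cyc_wreath p k) ^ (pw_val v k).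
Proof. by []. Qed.

Lemma pw_valX u n k : pw_val (u ^+ n) k = (pw_val u k : cyc_wreath p k) ^+ n.
Proof.
elim: n => [|n IH]; first by [].
by rewrite expgS pw_valM IH -expgS.
Qed.

(** The base group given by coordinates instead of generators. It contains [pw_B] by [pw_B_base];
    the two are identified through their preimages, in [ext_B_base]. *)
Definition pw_base : set (pro_wreath p) := [set w | forall k, pw_top w k = 0%R].

Lemma pw_base_normal : normal_subgroup pw_base.
Proof.
split; first split=> //.
- by move=> u v bu bv k; rewrite pw_topM bu bv addr0.
- by move=> u bu k; rewrite pw_topV bu oppr0.
- by move=> u v bu k; rewrite pw_topJ.
Qed.

Lemma pw_base_y : pw_base (pw_y p).
Proof. by []. Qed.

Lemma pw_base_val u k : pw_base u -> exists f, pw_val u k = wr_baseg f.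
Proof.
move=> /(_ k); rewrite /pw_top; case: (pw_val u k) => c f /= ->.
by exists f.
Qed.

Lemma pw_base_commute u v : pw_base u -> pw_base v -> commute u v.
Proof.
move=> bu bv; apply: pw_inj => k; rewrite !pw_valM.
have [f ->] := pw_base_val k bu; have [g ->] := pw_base_val k bv.
by rewrite -!wr_basegD addrC.
Qed.

Lemma pw_base_exp u : pw_base u -> u ^+ p = 1.
Proof.
move=> bu; apply: pw_inj => k; rewrite pw_valX.
have [f ->] := pw_base_val k bu.
rewrite -wr_basegMn (_ : (f *+ p)%R = 0%R)//; apply/ffunP => d.
by rewrite ffunMnE [RHS]ffunE mulrn_pchar// pchar_Fp.
Qed.

Lemma continuous_pw_top (X : topologicalType) (f : X -> pro_wreath p) k :
  continuous f -> open [set t | pw_top (f t) k = 0%R].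
Proof.
move=> cf.
have : open ((fun t =>
  pw_val (f t) k : discrete_topology (cyc_wreath p k)) @^-1`
    [set c | c.1 = 0%R]).
  have /continuousP : continuous
      (fun t => pw_val (f t) k : discrete_topology (cyc_wreath p k)).
    by move=> t; apply: (@continuous_comp _ _ _ f (fun w => pw_val w k :
      discrete_topology (cyc_wreath p k)));
        [exact: cf|exact: pw_val_continuous].
  by apply; exact: discrete_open.
by [].
Qed.

Lemma closed_pw_val (X : topologicalType) (f : X -> pro_wreath p) k c :
  continuous f -> closed [set t | pw_val (f t) k = c].
Proof.
move=> cf.
have : closed ((fun t =>
  pw_val (f t) k : discrete_topology (cyc_wreath p k)) @^-1`
    [set c]).
  apply: preimage_closed; last exact: discrete_closed.
  by move=> t _; apply: (@continuous_comp _ _ _ f (fun w => pw_val w k :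
      discrete_topology (cyc_wreath p k)));
        [exact: cf|exact: pw_val_continuous].
by [].
Qed.

Lemma closed_pw_base : closed pw_base.
Proof.
have -> : pw_base = \bigcap_k ~` [set u | ~ pw_top u k = 0%R].
  apply/seteqP; split=> [u bu k _ /=|u h k]; first by rewrite bu; apply.
  by apply: contrapT; exact: h.
apply: closed_bigI => k _.
have -> : ~` [set u | ~ pw_top u k = 0%R] = [set u | pw_top u k = 0%R].
  by apply/seteqP; split=> u /=; [exact: contrapT|move=> h; apply].
apply: open_subgroup_closed; last first.
  by apply: (@continuous_pw_top _ id k) => w; exact: cvg_id.
split=> //=; first by move=> u v hu hv; rewrite pw_topM hu hv addr0.
by move=> u hu; rewrite pw_topV hu oppr0.
Qed.

Lemma expgzS (T : groupType) (u : T) (i : int) :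
  expgz u (i + 1)%R = expgz u i * u.
Proof.
case: i => [n|n]; first by rewrite -PoszD addn1 /= expgSr.
rewrite NegzE; case: n => [|n]; first by rewrite addNr /= expg1 mulVg.
have -> : (- n.+2%:Z + 1 = - n.+1%:Z)%R.
  by rewrite -[n.+2]addn1 PoszD opprD addrNK.
by rewrite -!NegzE /= [in RHS]expgS invgM mulgVK.
Qed.

End ProWreathBase.

Section ClosedGenerated.
Variables (T : topGroupType) (A : set T).

Lemma sub_closed_generated : A `<=` closed_generated A.
Proof. by move=> u Au K [_ _]; apply. Qed.

Lemma closed_generated_min K : subgroup K -> closed K -> A `<=` K ->
  closed_generated A `<=` K.
Proof. by move=> sK cK AK u; apply. Qed.

Lemma closed_closed_generated : closed (closed_generated A).
Proof. by apply: closed_bigI => K []. Qed.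

Lemma subgroup_closed_generated : subgroup (closed_generated A).
Proof.
split.
- by move=> K [[]].
- move=> u v Ku Kv K hK; case: (hK) => -[_ KM _] _ _.
  by apply: KM; [exact: Ku|exact: Kv].
- move=> u Ku K hK; case: (hK) => -[_ _ KV] _ _.
  by apply: KV; exact: Ku.
Qed.

Lemma closed_generated_conj v : (forall u, A u -> closed_generated A (u ^ v)) ->
  forall u, closed_generated A u -> closed_generated A (u ^ v).
Proof.
move=> AJ u; have [K1 KM KV] := subgroup_closed_generated.
apply: (@closed_generated_min [set u | closed_generated A (u ^ v)]) => //.
- split=> /=; first by rewrite conj1g.
    by move=> a b Ka Kb; rewrite conjMg; exact: KM.
  by move=> a Ka; rewrite conjVg; exact: KV.
- apply: preimage_closed; last exact: closed_closed_generated.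
  by move=> w _; exact: conjg_continuous.
Qed.

End ClosedGenerated.

Section ProWreathB.
Variables (p : nat) (hp : prime p).

Lemma pw_B_base : @pw_B p `<=` @pw_base p.
Proof.
have [sB BJ] := @pw_base_normal p.
apply: closed_generated_min => //; first exact: closed_pw_base.
by move=> _ [i _ <-]; apply: BJ; exact: pw_base_y.
Qed.

Lemma pw_B_y : @pw_B p (pw_y p).
Proof.
apply: sub_closed_generated; exists 0%R => //=.
by rewrite expg0 conjg1.
Qed.

Lemma pw_B_conj u : @pw_B p u -> @pw_B p (u ^ pw_x p).
Proof.
apply: closed_generated_conj => _ [i _ <-]; apply: sub_closed_generated.
by exists (i + 1)%R => //; rewrite expgzS conjgM.
Qed.

Lemma psi1 k d : psi k (1 : {poly 'F_p})%R d = (1 *+ (d == 0))%R.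
Proof.
rewrite ffunE size_poly1 big_ord1 coef1 /=.
congr (_ *+ nat_of_bool _)%R; rewrite eq_sym; congr (_ == _).
by apply/val_inj; rewrite /= mod0n.
Qed.

Lemma wr_base1_psi k : wr_base (cyc p k) (1 : 'F_p)%R = wr_baseg (psi k 1).
Proof. by congr pair; apply/ffunP => d; rewrite psi1 ffunE. Qed.

Lemma pw_val_yJ (v : pro_wreath p) k :
  pw_val (pw_y p ^ v) k = wr_baseg [ffun d => psi k 1 (d - pw_top v k)%R].
Proof. by rewrite pw_valJ [pw_val (pw_y p) k]wr_base1_psi wr_basegJ. Qed.

(** y is the polynomial 1 and conjugation by x^n is multiplication by X^n; additively the commutator
    is X^n - 1. *)
Lemma pw_val_comm_yx n k :
  pw_val [~ pw_y p, pw_x p ^+ n] k = wr_baseg (psi k ('X^n - 1)%R).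
Proof.
rewrite commgEl pw_valM pw_valV pw_val_yJ [pw_val (pw_y p) k]wr_base1_psi.
rewrite -wr_basegN -wr_basegD pw_topXx -(psi_mulXn hp) mul1r addrC.
by rewrite psiD psiN.
Qed.

Lemma pw_val_psi (u : pro_wreath p) k i P : pw_val u (k + i)%N = wr_baseg (psi
  (k + i) P) ->
  pw_val u k = wr_baseg (psi k P).
Proof.
elim: i => [|i IH]; first by rewrite addn0.
rewrite addnS => e; apply: IH; rewrite -pw_compat e.
by congr pair; [exact: cyc_red0|exact: psi_red].
Qed.

Lemma pw_val_le (u v : pro_wreath p) k i :
  pw_val u (k + i)%N = pw_val v (k + i)%N -> pw_val u k = pw_val v k.
Proof.
elim: i => [|i IH]; first by rewrite addn0.
by rewrite addnS => e; apply: IH; rewrite -(pw_compat u) -(pw_compat v) e.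
Qed.

(** The polynomial of u is chosen at the deep level k + m and is still nonzero at level k, so
    [psi_ideal_subX] applies. The element v depends on m. *)
Lemma pw_base_subX (I : set (pro_wreath p)) k m u : subgroup I ->
  (forall v, I v -> I (v ^ pw_x p)) -> I u -> pw_base u ->
  pw_val u k <> (1 : cyc_wreath p k) ->
  exists2 v, I v & pw_val v (k + m)%N =
    pw_val [~ pw_y p, pw_x p ^+ (p ^ k)] (k + m)%N.
Proof.
move=> [I1 IM IV] IJ Iu bu uk; rewrite pw_val_comm_yx.
have [f uf] := pw_base_val (k + m) bu.
have [P Pf] := psi_surj f; rewrite -Pf in uf.
pose J : set (cyc_wreath p (k + m)) := [set pw_val v (k + m)%N | v in I].
have sJ : subgroup J.
  split; first by exists 1; [exact: I1|].
    move=> _ _ [a Ia <-] [b Ib <-]; exists (a * b); first exact: IM.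
    exact: pw_valM.
  move=> _ [a Ia <-]; exists a^-1; first exact: IV.
  exact: pw_valV.
have JJ c : J c -> J (c ^ wr_top 'F_p (inZp 1 : cyc p (k + m))).
  move=> [a Ia <-]; exists (a ^ pw_x p); first exact: IJ.
  exact: pw_valJ.
have JP : J (wr_baseg (psi (k + m) P)) by exists u.
have P0 : (psi k P != 0)%R.
  apply/negP => /eqP P0; apply: uk.
  by rewrite (pw_val_psi uf) P0 wr_baseg0.
have [v Iv e] := psi_ideal_subX hp sJ JJ JP P0.
by exists v.
Qed.

End ProWreathB.

(** * Normal subgroups of the central extension *)

Section CentralExtension.
Variables (p : nat) (T : topGroupType) (S : nat -> set T) (x y : T)
  (proj : T -> pro_wreath p).
Hypotheses (hp : prime p) (cT : compact [set: T]) (hS : filtration_series S)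
  (Sp : forall n, exists k, gindex setT (S n) = (p ^ k)%N)
  (gen : forall n M, subgroup M -> S n `<=` M -> M x -> M y -> M = setT)
  (projM : {morph proj : u v / u * v}) (proj_cont : continuous proj)
  (projx : proj x = pw_x p) (projy : proj y = pw_y p).

Definition ext_ker : set T := proj @^-1` [set 1].
Definition ext_base : set T := proj @^-1` @pw_base p.

Hypotheses (kerC : forall u v, ext_ker u -> commute u v)
  (kerX : forall u, ext_ker u -> u ^+ p = 1).

Lemma ext_ker_subgroup : subgroup ext_ker.
Proof. by apply: subgroup_preimage => //; exact: subgroup1. Qed.

Lemma ext_ker_closed : closed ext_ker.
Proof.
apply: preimage_closed => [u _|]; first exact: proj_cont.
exact/accessible_closed_set1/hausdorff_accessible/pw_hausdorff.
Qed.

Lemma ext_base_normal : normal_subgroup ext_base.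
Proof. exact/normal_subgroup_preimage/pw_base_normal. Qed.

Lemma ext_base_subgroup : subgroup ext_base.
Proof. by case: ext_base_normal. Qed.

Lemma ext_base_closed : closed ext_base.
Proof.
by apply: preimage_closed => [u _|]; [exact: proj_cont|exact: closed_pw_base].
Qed.

Lemma ext_base_y : ext_base y.
Proof. by rewrite /ext_base /= projy; exact: pw_base_y. Qed.

Lemma sub_ext_ker_base : ext_ker `<=` ext_base.
Proof. by move=> u uk; rewrite /ext_base /= uk => k; exact: pw_top1. Qed.

Lemma ext_base_comm u v : ext_base u -> ext_base v -> ext_ker [~ u, v].
Proof.
move=> bu bv; rewrite /ext_ker /= (morph_comm projM).
by apply/eqP/commgP; exact: pw_base_commute.
Qed.

Lemma ext_base_exp u : ext_base u -> ext_ker (u ^+ p).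
Proof. by move=> bu; rewrite /ext_ker /= (morph_exp projM) pw_base_exp. Qed.

Lemma ker_conj u v : ext_ker u -> u ^ v = u.
Proof. by move=> ku; rewrite conjgE (kerC v ku) mulKg. Qed.

Lemma filtration_sub_top k : exists n, forall u,
  S n u -> pw_top (proj u) k = 0%R.
Proof.
apply: (filtration_basis cT hS (continuous_pw_top k proj_cont)).
by rewrite /= (morph_one projM) pw_top1.
Qed.

(** The quotient by the normal closure of y is procyclic, seen modulo S_n: a power of x lies in S_n,
    so the products x^a m form a subgroup, and it contains both generators. *)
Lemma gen_cyc_ext M n : subgroup M -> S n `<=` M -> M y ->
  (forall u, M u -> M (u ^ x)) -> cyc_ext M x = setT.
Proof.
move=> sM SM My MJ; apply: (@gen n).
- apply: (cyc_ext_subgroup sM MJ (d := p ^ gdim S p setT n)).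
    by rewrite expn_gt0 prime_gt0.
  by apply: SM; exact: filtration_exp.
- exact: subset_trans (@cyc_ext_sub _ _ _).
- exact: cyc_ext_gen.
- exact: cyc_ext_sub.
Qed.

Lemma mul_filtration_conj E n : (forall u, E u -> E (u ^ x)) ->
  forall u, mul_set E (S n) u -> mul_set E (S n) (u ^ x).
Proof.
move=> EJ _ [e Ee [s Ss <-]]; rewrite conjMg; exists (e ^ x); first exact: EJ.
by exists (s ^ x) => //; case: (filtration_normal hS n) => _; apply.
Qed.

(** Modulo a small S_N every h is x^a e with e in E. If h has trivial top coordinates, a is highly
    divisible by p and x^a disappears modulo S_n. *)
Lemma ext_base_min E : subgroup E -> closed E -> E `<=` ext_base -> E y ->
  (forall u, E u -> E (u ^ x)) -> ext_base `<=` E.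
Proof.
move=> sE cE Eb Ey EJ h bh.
move/(closed_filtrationP cT hS): cE; apply => n.
(* The level k is chosen so that x^(p^k) lies in S_n, and N so that S_N lies in S_n and is invisible
   in the top coordinate at level k. *)
pose k := gdim S p setT n; have [m Sm] := filtration_sub_top k.
pose N := maxn m n.
have SNm : S N `<=` S m by apply: (filtration_le hS); exact: leq_maxl.
have SNn : S N `<=` S n by apply: (filtration_le hS); exact: leq_maxr.
have sES i := subgroup_mul sE (filtration_normal hS i).
have E1 : E 1 by case: sE.
have := @gen_cyc_ext (mul_set E (S N)) N (sES N) (mul_setr E1)
  (mul_setl (filtration1 hS N) Ey) (mul_filtration_conj EJ).
move=> /seteqP[_ /(_ h I)[a _ [_ [e Ee [s Ss <-]] ehs]]].
have := bh k; rewrite -ehs !projM !pw_topM (Eb _ Ee k) (Sm _ (SNm _ Ss)) !addr0.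
rewrite (morph_exp projM) projx pw_topXx => /(cyc_inZp_eq0 hp)/dvdnP[b ab].
have xa : S n (x ^+ a).
  rewrite ab mulnC expgnA; apply: subgroupX; first exact: filtration_subgroup.
  exact: filtration_exp.
case: (sES n) => _ EM _; apply: EM.
  by apply: mul_setr xa.
by exists e => //; exists s => //; exact: SNn.
Qed.

Lemma ext_B_base : proj @^-1` @pw_B p = ext_base.
Proof.
apply/seteqP; split; first by move=> u; exact: pw_B_base.
apply: ext_base_min.
- apply: subgroup_preimage => //; exact: subgroup_closed_generated.
- apply: preimage_closed => [u _|]; first exact: proj_cont.
  exact: closed_closed_generated.
- by move=> u; exact: pw_B_base.
- by rewrite /= projy; exact: pw_B_y.
- by move=> u /= Bu; rewrite (morph_conj projM) projx; exact: pw_B_conj.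
Qed.

Lemma ext_base_relation K : closed K -> normal_subgroup K ->
  K `<=` ext_base -> ~ K `<=` ext_ker ->
  exists k u z, [/\ K u, ext_ker z & [~ y, x ^+ (p ^ k)] = u * z].
Proof.
move=> cK [sK KJ] Kb nK.
have [u [Ku nu]] : exists u, K u /\ proj u <> 1.
  by apply: contrapT => h; apply: nK => u Ku; apply: contrapT => nu; apply: h;
    exists u.
have [k nk] : exists k, pw_val (proj u) k <> (1 : cyc_wreath p k).
  by apply: contrapT => h; apply: nu; apply: pw_inj => k; apply: contrapT => nk;
    apply: h; exists k.
pose c := [~ y, x ^+ (p ^ k)%N].
have pc : proj c = [~ pw_y p, pw_x p ^+ (p ^ k)%N].
  by rewrite (morph_comm projM) (morph_exp projM) projx projy.
pose I := [set proj v | v in K]; have [K1 KM KV] := sK.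
have sI : subgroup I.
  split; first by exists 1 => //; exact: morph_one.
    by move=> _ _ [a Ka <-] [b Kb' <-]; exists (a * b);
      [exact: KM|exact: projM].
  by move=> _ [a Ka <-]; exists a^-1; [exact: KV|exact: morph_inv].
have IJ v : I v -> I (v ^ pw_x p).
  move=> [a Ka <-]; exists (a ^ x); first exact: KJ.
  by rewrite (morph_conj projM) projx.
have cptK : compact K by apply: (subclosed_compact cK cT).
(* The elements of K agreeing with c at level k + m form a decreasing chain of nonempty closed sets;
   compactness gives one element agreeing with c at every level. *)
have [m|m v /= e|m|v [Kv vc]] := @compact_decreasing_capI _ K
    (fun m => [set v | pw_val (proj v) (k + m)%N = pw_val (proj c) (k + m)%N])
      cptK.
- exact: closed_pw_val.
- by move: e; rewrite addnS -addn1 => /pw_val_le.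
- have Iu : I (proj u) by exists u.
  have [_ [v Kv <-] e] := pw_base_subX hp m sI IJ Iu (Kb _ Ku) nk.
  by exists v; split=> //=; rewrite pc.
exists k, v, (v^-1 * c); split=> //; last by rewrite mulVKg.
have -> : ext_ker (v^-1 * c) <-> proj v = proj c.
  rewrite /ext_ker /= projM (morph_inv projM); split=> [e|->];
    last exact: mulVg.
  by rewrite -[RHS](mulVKg (proj v)) e mulg1.
apply: pw_inj => j; apply: (@pw_val_le _ _ _ j k).
by rewrite addnC; exact: vc.
Qed.

Lemma fin_index_base K : closed K -> normal_subgroup K ->
  K `<=` ext_base -> ~ K `<=` ext_ker -> fin_index ext_base K.
Proof.
move=> cK nK Kb nKk; have [sK KJ] := nK; have [K1 KM KV] := sK.
have [k [u [z [Ku kz rel]]]] := ext_base_relation cK nK Kb nKk.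
pose q := (p ^ k)%N; have q0 : (0 < q)%N by rewrite expn_gt0 prime_gt0.
have p0 := prime_gt0 hp.
pose Y i := y ^ (x ^+ i).
have bY i : ext_base (Y i).
  by case: ext_base_normal => _; apply; exact: ext_base_y.
have YJ i : Y i ^ x = Y i.+1 by rewrite /Y expgSr conjgM.
have Y0 : Y 0%N = y by rewrite /Y expg0 conjg1.
pose s1 := z :: y ^+ p :: [seq [~ y, Y i] | i <- iota 0 q].
pose s2 := [seq Y i | i <- iota 0 q].
have s1k e : e \in s1 -> ext_ker e.
  rewrite !in_cons => /or3P[/eqP->//|/eqP->|/mapP[i _ ->]].
    exact/ext_base_exp/ext_base_y.
  exact/ext_base_comm/bY/ext_base_y.
have conjK v (M : set T) : subgroup M -> subgroup [set w | M (w ^ v)].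
  move=> [M1 MM MV]; split=> /=; first by rewrite conj1g.
    by move=> a b Ma Mb; rewrite conjMg; exact: MM.
  by move=> a Ma; rewrite conjVg; exact: MV.
(* Two stages are needed, because the conjugates of y commute and have exponent p only modulo D. The
   elements adjoined to K in this first stage are central, so D is normal. *)
have [e _ v Kv|e /s1k ke|e f /s1k ke _|D [sD KD s1D fD Dmin]] :=
    fin_index_extend (s := s1) p0 sK.
- exact: KJ.
- by rewrite kerX.
- have -> // : [~ e, f] = 1 by apply/eqP/commgP; exact: kerC.
have Db : D `<=` ext_base.
  by apply: Dmin => //;
    [exact: ext_base_subgroup|move=> e /s1k/sub_ext_ker_base].
have DJ w v : D w -> D (w ^ v).
  apply: (Dmin [set w | D (w ^ v)]); first exact: conjK.
    by move=> a Ka; apply: KD; exact: KJ.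
  by move=> e es /=; rewrite ker_conj; [exact: s1D|exact: s1k].
have [D1 DM DV] := sD.
have DYp i : D (Y i ^+ p).
  rewrite -conjXg ker_conj; last exact/ext_base_exp/ext_base_y.
  by apply: s1D; rewrite !in_cons eqxx orbT.
have DR0 i : (i < q)%N -> D [~ y, Y i].
  move=> iq; apply: s1D; rewrite !in_cons; apply/orP; right; apply/orP; right.
  by apply/mapP; exists i => //; rewrite mem_iota.
have DRle i j : (i <= j < q)%N -> D [~ Y i, Y j].
  move=> /andP[ij jq].
  (* Conjugating back by x^i reduces all the commutators to the q ones that were adjoined. *)
  have -> : [~ Y i, Y j] = [~ y, Y (j - i)%N] ^ (x ^+ i).
    by rewrite conjRg; congr [~ _, _]; rewrite /Y -conjgM -expgnDr subnK.
  by apply/DJ/DR0; apply: leq_ltn_trans jq; exact: leq_subr.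
have [e /mapP[i _ ->] v Dv|e /mapP[i _ ->]|_ _ /mapP[i iq ->] /mapP[j jq ->]|
    E [sE DE s2E fE Emin]] := fin_index_extend (s := s2) p0 sD.
- exact: DJ.
- exact: DYp.
- move: iq jq; rewrite !mem_iota !add0n /= => iq jq.
  have [ij|/ltnW ji] := leqP i j; first by apply: DRle; rewrite ij.
  by rewrite -invgR; apply: DV; apply: DRle; rewrite ji.
have [E1 EM EV] := sE.
have EY i : (i < q)%N -> E (Y i).
  by move=> iq; apply: s2E; apply/mapP; exists i => //; rewrite mem_iota.
have Ey : E y by rewrite -Y0; exact: EY.
(* The relation closes up the list: conjugation by x sends the last adjoined conjugate of y to y u
   z, already in E, so E is stable under x. *)
have EYq : E (Y q).
  have -> : Y q = y * (u * z) by rewrite -rel commgEl mulVKg.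
  apply: (EM) => //; apply: (EM); apply: DE; first exact: KD.
  by apply: s1D; rewrite mem_head.
have EJ v : E v -> E (v ^ x).
  apply: (Emin [set v | E (v ^ x)]); first exact: conjK.
    by move=> a Da; apply: DE; exact: DJ.
  move=> _ /mapP[i + ->] /=; rewrite mem_iota add0n /= => iq; rewrite YJ.
  have [->//|iq'] := eqVneq i.+1 q.
  by apply: EY; rewrite ltn_neqAle iq'.
have fEK : fin_index E K by exact: fin_indexM fD.
have KE : K `<=` E by exact: subset_trans DE.
have Eb : E `<=` ext_base.
  by apply: Emin => //; [exact: ext_base_subgroup|move=> _ /mapP[i _ ->]].
have cE : closed E by exact: closed_fin_index fEK sE KE K1.
exact: fin_indexS (ext_base_min sE cE Eb Ey EJ) fEK.
Qed.

(** Otherwise u would fix the image of y. At level k that image is the indicator of 0, and u moves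
    it to the indicator of its nonzero top coordinate; the two differ there. *)
Lemma comm_y_nker u k : pw_top (proj u) k <> 0%R -> ~ ext_ker [~ y, u].
Proof.
move=> uk; rewrite /ext_ker /= (morph_comm projM) projy => /eqP.
rewrite -conjg_fix => /eqP/(congr1 (fun w => pw_val w k)).
rewrite pw_val_yJ [RHS]wr_base1_psi => -[/ffunP/(_ (pw_top (proj u) k))].
rewrite ffunE subrr !psi1 eqxx.
by case: eqP => // _; rewrite mulr0n => /eqP; rewrite oner_eq0.
Qed.

Lemma fin_index_nbase K : closed K -> normal_subgroup K ->
  ~ K `<=` ext_base -> fin_index setT K.
Proof.
move=> cK nK nKb; have [sK KJ] := nK; have [K1 KM KV] := sK.
have [u [Ku [j uj]]] : exists u, K u /\ exists j, pw_top (proj u) j <> 0%R.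
  apply: contrapT => h; apply: nKb => u Ku k; apply: contrapT => uk.
  by apply: h; exists u; split=> //; exists k.
have nKH := normal_subgroupI ext_base_normal nK.
have sb := ext_base_subgroup.
have fKH : fin_index ext_base (ext_base `&` K).
  apply: fin_index_base => //; first by apply: closedI => //;
    exact: ext_base_closed.
  move=> h; apply: (comm_y_nker uj); apply: h; split.
    rewrite commgEl; have [_ bM bV] := sb; apply: bM.
      by apply: bV; exact: ext_base_y.
    by case: ext_base_normal => _; apply; exact: ext_base_y.
  by rewrite commgEr; apply: KM => //; apply: KJ; exact: KV.
have fbK : fin_index ext_base K by apply: fin_indexW fKH => //;
  case: nKH => -[].
pose H := mul_set ext_base K.
have nH : normal_subgroup H by apply: normal_subgroup_mul => //;
  exact: ext_base_normal.
have sH : subgroup H by case: nH.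
have fHK : fin_index H K by rewrite /fin_index /H cosets_mul.
have KH : K `<=` H by apply: mul_setr; case: sb.
have bH : ext_base `<=` H by exact: mul_setl.
have cH : closed H by exact: closed_fin_index fHK sH KH K1.
have Hy : H y by apply: bH; exact: ext_base_y.
have HJ v : H v -> H (v ^ x) by case: nH => _; apply.
have sHS n := subgroup_mul sH (filtration_normal hS n).
(* The exponent p^j comes from the coordinate of u and not from n, so it can be tested modulo every
   S_n and closedness of H applies. *)
have Hx : H (x ^+ (p ^ j)%N).
  move/(closed_filtrationP cT hS): cH; apply => n.
  have [HS1 HSM HSV] := sHS n.
  have [m Sm] := filtration_sub_top j; pose N := maxn m n.
  have SNm : S N `<=` S m by apply: (filtration_le hS); exact: leq_maxl.
  have SNn : S N `<=` S n by apply: (filtration_le hS); exact: leq_maxr.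
  have b1 : ext_base 1 by case: sb.
  have bJ v : ext_base v -> ext_base (v ^ x) by case: ext_base_normal => _;
    apply.
  have := @gen_cyc_ext (mul_set ext_base (S N)) N
    (subgroup_mul sb (filtration_normal hS N)) (mul_setr b1)
    (mul_setl (filtration1 hS N) ext_base_y) (mul_filtration_conj bJ).
  move=> /seteqP[_ /(_ u I)[a _ [_ [h bh [s Ss <-]] e]]].
  have paj : ~~ (p ^ j %| a)%N.
    apply/negP => /(cyc_inZp_eq0 hp) a0; apply: uj; rewrite -e !projM !pw_topM.
    by rewrite (bh j) (Sm _ (SNm _ Ss)) !addr0 (morph_exp projM) projx pw_topXx.
  have a0 : (0 < a)%N by case: a paj {e} => //; rewrite dvdn0.
  have xa : mul_set H (S n) (x ^+ a).
    have -> : x ^+ a = u * (h * s)^-1 by rewrite -e mulgK.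
    apply: (HSM); first by apply: mul_setl; [exact: filtration1|exact: KH].
    by apply: HSV; exists h; [exact: bH|exists s => //; exact: SNn].
  pose e' := gdim S p setT n.
  have xe : mul_set H (S n) (x ^+ (p ^ e')).
    by apply: mul_setr; [case: sH|exact: filtration_exp].
  have := subgroup_gcd_exp (sHS n) a0 xa xe.
  (* The gcd of a and p^e' is a power p^i; as p^j does not divide a, i is at most j, and x^(p^j) is
     a power of x^(p^i). *)
  have /(dvdn_pfactor _ _ hp)[i _ ei] := dvdn_gcdr a (p ^ e').
  rewrite ei => xi.
  have ij : (i <= j)%N.
    apply/ltnW; rewrite ltnNge; apply/negP => ji; case/negP: paj.
    apply: dvdn_trans (dvdn_gcdl a (p ^ e')); rewrite ei.
    exact: dvdn_exp2l.
  by rewrite -(subnKC ij) expnD expgnA; exact: subgroupX.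
pose M := cyc_ext H x.
have pj0 : (0 < p ^ j)%N by rewrite expn_gt0 prime_gt0.
have sM : subgroup M by exact: (cyc_ext_subgroup sH HJ pj0 Hx).
have HM : H `<=` M by exact: cyc_ext_sub.
have fM : fin_index M H by exact: (fin_index_cyc_ext sH pj0 Hx).
have cM : closed M by apply: closed_fin_index fM sM HM _; case: sH.
have MT : M = setT.
  apply/seteqP; split=> // v _.
  move/(closed_filtrationP cT hS): cM; apply => n.
  have -> // : mul_set M (S n) = setT.
  apply: (@gen n); first exact: subgroup_mul (filtration_normal hS n).
  - by apply: mul_setr; case: sM.
  - by apply: mul_setl; [exact: filtration1|exact: cyc_ext_gen].
  - by apply: mul_setl; [exact: filtration1|exact: HM].
by rewrite -MT; exact: fin_indexM fM fHK.
Qed.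

End CentralExtension.

(** * Hausdorff dimensions *)

Section Dimension.
Variables (R : realType) (p : nat) (T : topGroupType) (S : nat -> set T).
Hypotheses (hp : prime p) (hS : filtration_series S)
  (Sp : forall n, exists k, gindex setT (S n) = (p ^ k)%N).

Lemma logp_exp k : logp R p (p ^ k)%N = k%:R%R.
Proof.
have lp : (ln p%:R != 0 :> R)%R.
  by rewrite gt_eqF// ln_gt0// ltr1n prime_gt1.
by rewrite /logp natrX lnXn ?ltr0n ?prime_gt0// -[(ln _ *+ k)%R]mulr_natl mulfK.
Qed.

Lemma hdimE (K : set T) : subgroup K -> hdim R p S K =
  limn_inf (fun n => (gdim S p K n)%:R / (gdim S p setT n)%:R)%R.
Proof.
move=> sK; rewrite /hdim; congr limn_inf; apply/funext => n.
by rewrite (gindexE hS hp Sp)// (gindexTE hS hp Sp) !logp_exp.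
Qed.

Lemma leq_gdim (K L : set T) n : subgroup K -> subgroup L -> K `<=` L ->
  (gdim S p K n <= gdim S p L n)%N.
Proof.
move=> sK sL KL; have := prime_gt1 hp => p1.
rewrite -(leq_exp2l _ _ p1) -!(gindexE hS hp Sp)//.
apply: gindexS; first exact: mul_setS.
exact: fin_indexS (filtration_fin_index hp Sp n).
Qed.

Lemma leq_gdimT (K : set T) n : subgroup K ->
  (gdim S p K n <= gdim S p setT n)%N.
Proof. by move=> sK; apply: leq_gdim. Qed.

(** A crude bound by |L : K| itself in place of its logarithm, from m < p^m; only its independence
    of n matters. *)
Lemma gdim_fin_index (K L : set T) n : subgroup K -> subgroup L -> K `<=` L ->
  fin_index L K -> (gdim S p L n <= gindex L K + gdim S p K n)%N.
Proof.
move=> sK sL KL f; have := prime_gt1 hp => p1.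
rewrite -(leq_exp2l _ _ p1) expnD -!(gindexE hS hp Sp)//.
apply: (leq_trans (leq_gindex_mul sK sL (filtration_normal hS n) KL f _)).
  exact: (filtration_fin_index hp Sp n).
by rewrite leq_mul2r; apply/orP; right; apply/ltnW/ltn_expl.
Qed.

Hypothesis gdim_infty :
  forall k, exists n, forall m, (n <= m)%N -> (k <= gdim S p setT m)%N.

Lemma hdim_unit_bounded (K : set T) : subgroup K ->
  unit_bounded (fun n => (gdim S p K n)%:R / (gdim S p setT n)%:R : R)%R.
Proof.
move=> sK n; have := leq_gdimT n sK.
have [->|g0] := posnP (gdim S p setT n);
  first by rewrite invr0 mulr0 lexx ler01.
by move=> le; rewrite divr_ge0//= ler_pdivrMr ?ltr0n// mul1r ler_nat.
Qed.

Lemma hdim_ge0 (K : set T) : subgroup K -> (0 <= hdim R p S K)%R.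
Proof. by move=> sK; rewrite hdimE//; apply/limn_inf_ge0/hdim_unit_bounded. Qed.

Lemma le_hdim (K L : set T) : subgroup K -> subgroup L -> K `<=` L ->
  (hdim R p S K <= hdim R p S L)%R.
Proof.
move=> sK sL KL; rewrite !hdimE//.
apply: le_limn_inf; [exact: hdim_unit_bounded|exact: hdim_unit_bounded|].
by move=> n; rewrite ler_wpM2r ?invr_ge0// ler_nat leq_gdim.
Qed.

Lemma hdim_scale (K L : set T) (b c : R) : subgroup K -> subgroup L ->
  (0 <= b)%R ->
  (forall n, `|(gdim S p K n)%:R - b * (gdim S p L n)%:R| <= c)%R ->
  hdim R p S K = (b * hdim R p S L)%R.
Proof.
move=> sK sL b0 h; rewrite !hdimE//.
by apply: (limn_inf_quotient _ _ b0 gdim_infty h) => n; exact: leq_gdimT.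
Qed.

Lemma hdim_fin_index (K L : set T) : subgroup K -> subgroup L -> K `<=` L ->
  fin_index L K -> hdim R p S K = hdim R p S L.
Proof.
move=> sK sL KL f; rewrite -[RHS]mul1r.
apply: (@hdim_scale _ _ _ (gindex L K)%:R%R) => // n; rewrite mul1r.
have h1 := leq_gdim n sK sL KL; have h2 := gdim_fin_index n sK sL KL f.
rewrite distrC ger0_norm ?subr_ge0 ?ler_nat// lerBlDr -natrD ler_nat.
exact: h2.
Qed.

Lemma hdimT : hdim R p S [set: T] = 1%R.
Proof.
rewrite hdimE//; rewrite (_ : limn_inf _ = (1 * limn_inf (fun=> 1%R : R))%R).
  rewrite mul1r.
  by have [-> _] := cvg_limn_inf_sup (@cvg_cst R^o 1%R nat \oo _).
apply: limn_inf_scale_near; [exact: hdim_unit_bounded| |exact: ler01|].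
  by move=> n; rewrite ler01 lexx.
(* The quotient is 1 only once the index is nontrivial; at n = 0 it is 0 / 0 = 0. *)
move=> e e0; have [n hn] := gdim_infty 1; exists n => m /hn g0.
rewrite divff ?pnatr_eq0 -?lt0n// mulr1 subrr normr0; exact: ltW.
Qed.

Lemma hdim_central_interval (Z : set T) (a : R) : subgroup Z -> closed Z ->
  (forall u v, Z u -> commute u v) -> (forall u, Z u -> u ^+ p = 1) ->
  (0 <= a <= hdim R p S Z)%R ->
  exists K, [/\ closed K, normal_subgroup K & hdim R p S K = a].
Proof.
move=> sZ cZ ZC Zp /andP[a0 aZ].
(* If the dimension of Z is 0, division by zero gives b = 0, which is the right factor since then a
   = 0. *)
pose b := (a / hdim R p S Z)%R.
have bE : (b * hdim R p S Z = a)%R.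
  have [Z0|Z0] := eqVneq (hdim R p S Z) 0%R; last by rewrite /b mulfVK.
  by rewrite Z0 mulr0; apply/le_anti; rewrite a0 -Z0 aZ.
have b0 : (0 <= b)%R by rewrite divr_ge0// hdim_ge0.
have b1 : (b <= 1)%R.
  have [Z0|Z0] := eqVneq (hdim R p S Z) 0%R.
    by rewrite /b Z0 invr0 mulr0 ler01.
  by rewrite ler_pdivrMr ?mul1r// lt_neqAle eq_sym Z0 hdim_ge0.
pose z n := gdim S p Z n; pose t n := Num.truncn (b * (z n)%:R)%R.
have tP n : ((t n)%:R <= b * (z n)%:R < (t n)%:R + 1)%R.
  by rewrite natr1 truncn_itv// mulr_ge0.
have z0 : z 0%N = 0%N.
  rewrite /z /gdim; have [-> _ _ _] := hS.
  rewrite (_ : mul_set Z setT = setT); first by rewrite gindex_id ?logn1.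
  by apply/seteqP; split=> // u _; apply: mul_setr => //; case: sZ.
have zS n : (z n <= z n.+1)%N by exact: gdim_central_le.
have [|n|n|K [cK nK KZ eK]] :=
    prescribed_central_subgroup hS hp Sp sZ ZC Zp (t := t) cZ.
- by rewrite /t z0 mulr0 truncn0.
- by apply: le_truncn; rewrite ler_wpM2l// ler_nat.
(* With d = z(n+1) - z(n) and b <= 1: t(n+1) <= b z(n) + b d < t(n) + 1 + d, and integrality gives
   the bound. *)
- rewrite leq_subLR -ltnS -(ltr_nat R).
  have /andP[_ h1] := tP n; have /andP[h2 _] := tP n.+1.
  rewrite -natr1 natrD; apply: (le_lt_trans h2).
  have -> : ((z n.+1)%:R = (z n)%:R + (z n.+1 - z n)%:R :> R)%R.
    by rewrite -natrD subnKC.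
  have : (b * (z n.+1 - z n)%:R <= (z n.+1 - z n)%:R)%R by rewrite ler_piMl.
  by move=> h3; rewrite mulrDr; lra.
exists K; split=> //; rewrite -bE.
apply: (@hdim_scale _ _ _ 1%R) => //; first by case: nK.
move=> n; rewrite eK; have := tP n => /andP[h1 h2].
by rewrite distrC ger0_norm ?subr_ge0// lerBlDl ltW.
Qed.

End Dimension.

(** * The normal spectrum of a central extension of W *)

Section Spectrum.
Variables (R : realType) (p : nat) (T : topGroupType) (S : nat -> set T)
  (x y : T) (proj : T -> pro_wreath p).
Hypotheses (hp : prime p) (cT : compact [set: T]) (hS : filtration_series S)
  (Sp : forall n, exists k, gindex setT (S n) = (p ^ k)%N)
  (gen : forall n M, subgroup M -> S n `<=` M -> M x -> M y -> M = setT)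
  (projM : {morph proj : u v / u * v}) (proj_cont : continuous proj)
  (projx : proj x = pw_x p) (projy : proj y = pw_y p)
  (kerC : forall u v, ext_ker proj u -> commute u v)
  (kerX : forall u, ext_ker proj u -> u ^+ p = 1).

(** x^(p^gdim) lies in S_m, whose elements have trivial top coordinate at level k for large m; since
    x has order p^k there, k <= gdim. *)
Lemma gdim_infty k :
  exists n, forall m, (n <= m)%N -> (k <= gdim S p setT m)%N.
Proof.
have [n Sn] := filtration_sub_top cT hS projM proj_cont k.
exists n => m nm;
  have := Sn _ (filtration_le hS nm (filtration_exp hS hp Sp m x)).
rewrite (morph_exp projM) projx pw_topXx => /(cyc_inZp_eq0 hp).
by rewrite dvdn_Pexp2l ?prime_gt1.
Qed.

Lemma central_extension_spectrum : hspec_normal R p S =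
  `[0%R, hdim R p S (ext_ker proj)] `|`
  [set hdim R p S (proj @^-1` @pw_B p)] `|` [set 1%R].
Proof.
rewrite (ext_B_base hp cT hS Sp gen)//.
have sk := ext_ker_subgroup projM; have sb := ext_base_subgroup projM.
apply/seteqP; split=> [_ [K [cK nK] <-]|a].
  have [sK _] := nK.
  have [Kk|nKk] := pselect (K `<=` ext_ker proj).
    left; left; rewrite /= in_itv /=.
    by rewrite (hdim_ge0 R hp hS Sp)// (le_hdim R hp hS Sp).
  have [Kb|nKb] := pselect (K `<=` ext_base proj).
    left; right; apply: (hdim_fin_index R hp hS Sp gdim_infty) => //.
    exact: (fin_index_base hp cT hS Sp gen).
  right; rewrite -(hdimT R hp hS Sp gdim_infty).
  apply: (hdim_fin_index R hp hS Sp gdim_infty) => //.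
  exact: (fin_index_nbase hp cT hS Sp gen).
case=> [[|->]|->].
- rewrite /= in_itv /= => /(hdim_central_interval hp hS Sp gdim_infty sk).
  case=> //; first exact: ext_ker_closed.
  by move=> K [cK nK <-]; exists K.
- exists (ext_base proj) => //; split; first exact: ext_base_closed.
  exact: ext_base_normal.
- by exists setT; [split|exact: hdimT gdim_infty].
Qed.

End Spectrum.

(** * Free pro-p groups *)

Section DiscreteSubgroup.
Variables (Q : groupType) (M : set Q) (sM : subgroup M).

Definition dsub_of (_ : subgroup M) := {q : Q | `[< M q >]}.
Definition dsub : Type := discrete_topology (dsub_of sM).

HB.instance Definition _ := DiscreteTopology.on dsub.
HB.instance Definition _ := Choice.on dsub.

Definition dsub_val (u : dsub) : Q := sval u.

Lemma dsub_valP u : M (dsub_val u).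
Proof. by case: u => q h; exact/asboolP. Qed.

Lemma dsub_inj : injective dsub_val.
Proof. by move=> u v; exact: val_inj. Qed.

Definition dsub_build q (Mq : M q) : dsub := exist _ q (asboolT Mq).

Definition dsub_one := let: And3 M1 _ _ := sM in dsub_build M1.
Definition dsub_mul u v := let: And3 _ MM _ := sM in
  dsub_build (MM _ _ (dsub_valP u) (dsub_valP v)).
Definition dsub_inv u := let: And3 _ _ MV := sM in
  dsub_build (MV _ (dsub_valP u)).

Lemma dsub_oneE : dsub_val dsub_one = 1.
Proof. by rewrite /dsub_one; case: sM. Qed.
Lemma dsub_mulE u v : dsub_val (dsub_mul u v) = dsub_val u * dsub_val v.
Proof. by rewrite /dsub_mul; case: sM. Qed.
Lemma dsub_invE u : dsub_val (dsub_inv u) = (dsub_val u)^-1.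
Proof. by rewrite /dsub_inv; case: sM. Qed.

Lemma dsub_mulA : associative dsub_mul.
Proof. by move=> u v w; apply: dsub_inj; rewrite !dsub_mulE mulgA. Qed.
Lemma dsub_mul1 : left_id dsub_one dsub_mul.
Proof. by move=> u; apply: dsub_inj; rewrite dsub_mulE dsub_oneE mul1g. Qed.
Lemma dsub_mulr1 : right_id dsub_one dsub_mul.
Proof. by move=> u; apply: dsub_inj; rewrite dsub_mulE dsub_oneE mulg1. Qed.
Lemma dsub_mulV : left_inverse dsub_one dsub_inv dsub_mul.
Proof. by move=> u; apply: dsub_inj;
  rewrite dsub_mulE dsub_invE dsub_oneE mulVg. Qed.
Lemma dsub_mulrV : right_inverse dsub_one dsub_inv dsub_mul.
Proof. by move=> u; apply: dsub_inj;
  rewrite dsub_mulE dsub_invE dsub_oneE mulgV. Qed.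

HB.instance Definition _ :=
  isGroup.Build dsub dsub_mulA dsub_mul1 dsub_mulr1 dsub_mulV dsub_mulrV.

Lemma dsub_mulg_continuous : continuous (fun u : dsub * dsub => u.1 * u.2).
Proof.
move=> [u v] A /nbhs_singleton /= Auv.
exists ([set u], [set v]); first by split; exact: discrete_set1.
by move=> [u' v'] /= [-> ->].
Qed.

Lemma dsub_invg_continuous : continuous (fun u : dsub => u^-1).
Proof. by apply/continuousP => A _; exact: discrete_open. Qed.

HB.instance Definition _ :=
  isTopologicalGroup.Build dsub dsub_mulg_continuous dsub_invg_continuous.

End DiscreteSubgroup.

Lemma gindex_inj (T U : groupType) (f : T -> U) (K L : set T) :
  {morph f : u v / u * v} -> injective f -> fin_index (f @` K) (f @` L) ->
  gindex K L = gindex (f @` K) (f @` L).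
Proof.
move=> fM fi fin.
have e : cosets (f @` K) (f @` L) = (fun C => f @` C) @` cosets K L.
  have E u : lcoset (f u) (f @` L) = f @` (lcoset u L).
    apply/seteqP; split=> [_ [_ [l Ll <-] <-]|_ [_ [l Ll <-] <-]].
      by exists (u * l); [exists l|rewrite fM].
    by exists (f l); [exists l|rewrite fM].
  apply/seteqP; split=> [_ [_ [u Ku <-] <-]|_ [_ [u Ku <-] <-]].
    by exists (lcoset u L); [exists u|rewrite E].
  by exists (f u); [exists u|rewrite E].
have i : injective (fun C : set T => f @` C).
  suff H C D : f @` C = f @` D -> C `<=` D.
    by move=> C D CD; apply/seteqP; split; apply: H.
  move=> CD u Cu; have : (f @` D) (f u) by rewrite -CD; exists u.
  by move=> [v Dv /fi <-].
apply/esym; apply: (gindex_image e) => [C D _ _|]; first exact: i.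
move: fin; rewrite /fin_index e (eq_finite_set (inj_card_eq _))// => C D _ _.
exact: i.
Qed.

Section FiniteQuotient.
Variables (p : nat) (hp : prime p) (Q : groupType).
Hypothesis Qp : exists k, gindex [set: Q] [set 1] = (p ^ k)%N.

Lemma quotient_fin_index : fin_index [set: Q] [set 1].
Proof.
by have [k e] := Qp; apply: fin_index_gindex; rewrite e expn_gt0 prime_gt0.
Qed.

Lemma finite_dsub (M : set Q) (sM : subgroup M) : finite_set [set: dsub sM].
Proof.
have fQ : finite_set [set: Q].
  move: quotient_fin_index; rewrite /fin_index.
  rewrite (eq_finite_set (inj_card_eq (f := fun u => lcoset u [set 1]) _))//.
  move=> u v _ _ /(lcosetP _ _ (@subgroup1 Q)) /= uv.
  by apply: (@mulgI _ u^-1); rewrite uv mulVg.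
rewrite -(eq_finite_set (inj_card_eq (f := @dsub_val _ _ sM) _)); last first.
  by move=> u v _ _; exact: dsub_inj.
exact: sub_finite_set fQ.
Qed.

(** A finite discrete group is compact, Hausdorff and totally disconnected, and by Lagrange the
    index of U in M divides |Q| = p^k. *)
Lemma pro_p_dsub (M : set Q) (sM : subgroup M) : pro_p p (dsub sM).
Proof.
have fM : {morph @dsub_val _ _ sM : u v / u * v} by exact: dsub_mulE.
split.
- exact/finite_compact/finite_dsub.
- exact: discrete_hausdorff.
- exact/zero_dimension_totally_disconnected/discrete_zero_dimension.
move=> U _ [sU _]; have [k e] := Qp.
have sV : subgroup (@dsub_val _ _ sM @` U).
  have [U1 UM UV] := sU; split; first by exists 1 => //; exact: morph_one.
    by move=> _ _ [a Ua <-] [b Ub <-]; exists (a * b); [exact: UM|exact: fM].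
  by move=> _ [a Ua <-]; exists a^-1; [exact: UV|exact: morph_inv].
have VT : range (@dsub_val _ _ sM) = M.
  apply/seteqP; split=> [_ [u _ <-]|q Mq]; first exact: dsub_valP.
  by exists (dsub_build sM Mq).
have UM : @dsub_val _ _ sM @` U `<=` M by move=> _ [u _ <-]; exact: dsub_valP.
have fMU : fin_index M (@dsub_val _ _ sM @` U).
  apply: (fin_indexW sV (M := [set 1])) => //; first by move=> _ ->; case: sV.
  exact: fin_indexS quotient_fin_index.
rewrite (gindex_inj fM (@dsub_inj _ _ sM)) ?VT//.
have h1 := gindexM (subgroupT Q) sM (@subgroup1 Q) _ (@subsetT _ M)
  quotient_fin_index.
have h2 := gindexM sM sV (@subgroup1 Q) _ UM
  (fin_indexS (@subsetT _ M) quotient_fin_index).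
have : (gindex M (@dsub_val _ _ sM @` U) %| p ^ k)%N.
  rewrite -e h1; last by move=> _ ->; case: (sM).
  rewrite h2; last by move=> _ ->; case: (sV).
  by rewrite mulnCA dvdn_mulr.
by case/(dvdn_pfactor _ _ hp) => m _ ->; exists m.
Qed.

End FiniteQuotient.

Section FreeProP.
Variables (p : nat) (hp : prime p) (F : topGroupType) (x y : F).
Hypothesis hF : free_pro_p p x y.

(* The projection of F onto the finite quotient Q = F/V and the morphism onto
   its subgroup M/V agree on x and y, hence coincide. *)
Lemma free_pro_p_gen (V M : set F) : open V -> normal_subgroup V ->
  subgroup M -> V `<=` M -> M x -> M y -> M = setT.
Proof.
move=> oV nV sM VM Mx My; have [sV _] := nV; have [M1 MM MV] := sM.
have [[_ _ _ Fp] univ] := hF.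
pose Vn := NormalSubgroup nV; pose Q : groupType := quo Vn.
pose pi : F -> Q := fun u => \pi_(quo Vn)%qT u.
have piM' : {morph pi : u v / u * v} by exact: piM.
have pi_surj q : exists u, pi u = q by exists (repr q); rewrite /pi reprK.
have piP u v : pi u = pi v <-> V (u^-1 * v) by exact: quo_eqP.
have kerpi : pi @^-1` [set 1] = V.
  apply/seteqP; split=> u /=; rewrite -(morph_one piM').
    by move=> /esym/piP; rewrite invg1 mul1g.
  by move=> Vu; apply/esym/piP; rewrite invg1 mul1g.
have Qp : exists k, gindex [set: Q] [set 1] = (p ^ k)%N.
  have [k e] := Fp _ oV nV; exists k; rewrite -e -kerpi.
  by rewrite -[in RHS](@preimage_setT _ _ pi) gindex_preimage//;
    exact: subgroup1.
pose N := [set pi u | u in M].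
have sN : subgroup N.
  split; first by exists 1 => //; exact: morph_one.
    by move=> _ _ [a Ma <-] [b Mb <-]; exists (a * b); [exact: MM|exact: piM'].
  by move=> _ [a Ma <-]; exists a^-1; [exact: MV|exact: morph_inv].
have Nx : N (pi x) by exists x.
have Ny : N (pi y) by exists y.
have sT := subgroupT Q.
have [f [[fM fc fx fy] _]] :=
  univ (dsub sN) (dsub_build sN Nx) (dsub_build sN Ny) (pro_p_dsub hp Qp sN).
(* The full quotient is also taken in the form [dsub sT], which supplies the discrete topology and
   the pro-p property needed for uniqueness. *)
have [h [_ huniq]] :=
  univ (dsub sT) (dsub_build sT (I : [set: Q] (pi x)))
    (dsub_build sT (I : [set: Q] (pi y))) (pro_p_dsub hp Qp sT).
pose g1 u : dsub sT := dsub_build sT (I : [set: Q] (pi u)).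
pose g2 u : dsub sT := dsub_build sT (I : [set: Q] (dsub_val (f u))).
have e1 : h = g1.
  apply: huniq; split=> //.
  - by move=> u v; apply: dsub_inj; rewrite dsub_mulE /= piM'.
  - apply/continuousP => A _.
    have -> : g1 @^-1` A = \bigcup_(u in g1 @^-1` A) lcoset u V.
      apply/seteqP; split=> [u Au|_ [u Au [v Vv <-]]].
        by exists u => //; exists 1; [case: sV|rewrite mulg1].
      have e : g1 (u * v) = g1 u.
        by apply: dsub_inj; apply/esym/piP; rewrite mulKg.
      by rewrite /= e.
    by apply: bigcup_open => u _; exact: open_lcoset.
have e2 : h = g2.
  apply: huniq; split.
  - by move=> u v; apply: dsub_inj; rewrite dsub_mulE /= fM dsub_mulE.
  - apply/continuousP => A _.
    have -> : g2 @^-1` A = f @^-1` [set w | A (dsub_build sT (I : [set: Q]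
      (dsub_val w)))] by [].
    by move/continuousP: fc; apply; exact: discrete_open.
  - by apply: dsub_inj; rewrite /= fx.
  - by apply: dsub_inj; rewrite /= fy.
apply/seteqP; split=> // u _.
have : g1 u = g2 u by rewrite -e1 -e2.
move/(congr1 (@dsub_val _ _ _)) => /= e.
have [v Mv /piP Vvu] : N (pi u) by rewrite e; exact: dsub_valP.
by rewrite -(mulVKg v u); apply: MM => //; exact: VM.
Qed.

End FreeProP.

(** * The group G *)

Section ExtensionGroup.
Variables (p : nat) (F : topGroupType) (phi : {multiplicative F -> pro_wreath
  p}).
Hypothesis phi_cont : continuous phi.

Let piG : F -> extG phi := fun f => \pi_(extG phi)%qT f.

Lemma pi_extG_surj (g : extG phi) : exists f, piG f = g.
Proof. by exists (repr g); exact: reprK. Qed.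

Lemma pi_extG_morph : {morph piG : u v / u * v}.
Proof. exact: piM. Qed.

Lemma extG_projM : {morph @extG_proj p F phi : u v / u * v}.
Proof.
move=> g h; have [u <-] := pi_extG_surj g; have [v <-] := pi_extG_surj h.
by rewrite -pi_extG_morph !extG_projE// gmulfM.
Qed.

Lemma extG_proj_continuous : continuous (@extG_proj p F phi).
Proof.
apply/continuousP => A oA.
have : open (piG @^-1` (@extG_proj p F phi @^-1` A)); last by [].
have -> : piG @^-1` (@extG_proj p F phi @^-1` A) = phi @^-1` A.
  by apply/seteqP; split=> u /=; rewrite extG_projE.
by move/continuousP: phi_cont; apply.
Qed.

Lemma extG_kerE : ext_ker (@extG_proj p F phi) = extZ phi.
Proof.
apply/seteqP; split=> [g|_ [r Rr <-]]; rewrite /ext_ker /=.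
  have [u <-] := pi_extG_surj g; rewrite extG_projE// => eu.
  by exists u.
by rewrite extG_projE.
Qed.

Lemma extG_kerC (g h : extG phi) : extZ phi g -> commute g h.
Proof.
move=> [r Rr <-]; have [u <-] := pi_extG_surj h.
apply: (etrans (esym (pi_extG_morph r u)) (etrans _ (pi_extG_morph u r))).
apply/esym/quo_eqP; rewrite invgM -mulgA.
by apply: sub_closed_generated; left; exists r => //; exists u.
Qed.

Lemma extG_kerX (g : extG phi) : extZ phi g -> g ^+ p = 1.
Proof.
move=> [r Rr <-]; rewrite -(morph_exp pi_extG_morph) -(morph_one pi_extG_morph).
apply/esym/quo_eqP; rewrite invg1 mul1g.
by apply: sub_closed_generated; right; exists r.
Qed.

Lemma extG_compact : compact [set: F] -> compact [set: extG phi].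
Proof.
move=> cF; have -> : [set: extG phi] = piG @` setT.
  by apply/seteqP; split=> // g _; have [u <-] := pi_extG_surj g; exists u.
apply: continuous_compact => //; apply: continuous_subspaceT.
exact: pi_quo_continuous.
Qed.

End ExtensionGroup.

Local Open Scope ring_scope.

Theorem corollary4p2 (R : realType) (p : nat) (hp : prime p) (hodd : odd p)
    (F : topGroupType) (x y : F) (hF : free_pro_p p x y)
    (phi : {multiplicative F -> pro_wreath p}) (phi_cont : continuous phi)
    (phi_x : phi x = pw_x p) (phi_y : phi y = pw_y p)
    (S : nat -> set (extG phi)) (hS : filtration_series S) :
  let xi := hdim R p S (extZ phi) in
  let eta := hdim R p S (extH phi) in
  hspec_normal R p S = `[0, xi] `|` [set eta] `|` [set 1].
Proof.
have [[cF _ _ Fp] _] := hF.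
pose piG : F -> extG phi := fun f => \pi_(extG phi)%qT f.
have piGM := @pi_extG_morph p F phi : {morph piG : u v / (u * v)%g}.
have piG_surj := @pi_extG_surj p F phi : forall g, exists f, piG f = g.
have piG_cont : continuous piG by exact: pi_quo_continuous.
have oS n : open (piG @^-1` S n).
  by move/continuousP: piG_cont; apply; exact: filtration_open.
have nS n : normal_subgroup (piG @^-1` S n).
  exact/(normal_subgroup_preimage piGM)/(filtration_normal hS).
(* Indices of open normal subgroups of G are read off in F, where the pro-p hypothesis is
   available. *)
have Sp n : exists k, gindex setT (S n) = (p ^ k)%N.
  have [k e] := Fp _ (oS n) (nS n); exists k; rewrite -e.
  rewrite -(gindex_preimage piGM) ?preimage_setT//.
  exact: filtration_subgroup.
have gen n (M : set (extG phi)) : subgroup M -> S n `<=` M ->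
    M (piG x) -> M (piG y) -> M = setT.
  move=> sM SM Mx My.
  have := free_pro_p_gen hp hF (oS n) (nS n) (subgroup_preimage piGM sM).
  move=> /(_ _ Mx My) MT; apply/seteqP; split=> // g _.
  have [u <-] := piG_surj g; suff : (piG @^-1` M) u by [].
  by rewrite MT// => v; exact: SM.
rewrite /= -(extG_kerE phi_cont).
apply: (central_extension_spectrum R hp (extG_compact cF) hS Sp gen).
- exact: extG_projM.
- exact: extG_proj_continuous.
- by rewrite extG_projE.
- by rewrite extG_projE.
- by move=> u v; rewrite extG_kerE//; exact: extG_kerC.
- by move=> u; rewrite extG_kerE//; exact: extG_kerX.
Qed.
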